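(* Let $E$ be a Banach lattice. The following hold. (i) $\text{r-a-MW}(E)$ is a subalgebra of $\mathrm{L}_r(E)$. Moreover, $\text{r-a-MW}(E)=\mathrm{L}_r(E)$ if and only if the identity operator $I_E$ belongs to $\text{a-MW}(E)$. (ii) If $E$ is Dedekind complete, then $(\text{r-a-MW}(E),\|\cdot\|_{\text{r-a-MW}})$ is a closed Riesz subalgebra and an order ideal of $(\mathrm{L}_r(E),\|\cdot\|_r)$.
   Context: Vector spaces are real and operators are linear. A sequence $(x_n)$ in a Banach lattice is disjoint if $|x_n|\wedge|x_m|=0$ for $n\neq m$. A bounded operator $S:E\to Y$ from a Banach lattice to a Banach space is almost MW (a-MW) if $f_n(Sx_n)\to 0$ for every disjoint bounded sequence $(x_n)$ in $E$ and every weakly convergent sequence $(f_n)$ in $Y'$. $\text{a-MW}(E)$ is the set of a-MW-operators $E\to E$. An operator $T:E\to E$ is a regularly a-MW-operator, $T\in\text{r-a-MW}(E)$, if $T=T_1-T_2$ with $T_1,T_2$ positive a-MW-operators. $\mathrm{L}_r(E)$ is the space of regular operators on $E$ (differences of two positive operators), with composition as multiplication, the order $S\le T$ iff $T-S$ is positive, and the regular norm $\|T\|_r=\inf\{\|S\|:\pm T\le S\}$ (equal to $\|\,|T|\,\|$ when $E$ is Dedekind complete). The norm on $\text{r-a-MW}(E)$ is $\|T\|_{\text{r-a-MW}}=\inf\{\|S\|:\pm T\le S\in\text{a-MW}(E)\}$. A Riesz subalgebra is a subalgebra that is also a vector sublattice. *)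

(* Defs.v *)
From HB Require Import structures.
From mathcomp Require Import all_boot all_order all_algebra.
From mathcomp Require Import all_classical all_reals all_analysis.

Set Implicit Arguments.
Unset Strict Implicit.
Unset Printing Implicit Defensive.

Import Order.TTheory GRing.Theory Num.Theory.
Import numFieldNormedType.Exports.

Local Open Scope classical_set_scope.
Local Open Scope ring_scope.

(* The order of a Banach lattice is a field of the structure, written [x <=L y],
   instead of that of the [Order] hierarchy: a structure inheriting from both
   [Order.POrder] and [CompleteNormedModule] would have to be declared before
   [Num.NumDomain].  Note that [`|x|] is the norm; the lattice absolute
   value is [labs x]. *)
HB.mixin Record isBanachLattice (R : realType) E of CompleteNormedModule R E := {
  vle : E -> E -> Prop ;
  vsup : E -> E -> E ;
  vinf : E -> E -> E ;
  vle_refl : forall x, vle x x ;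
  vle_anti : forall x y, vle x y -> vle y x -> x = y ;
  vle_trans : forall y x z, vle x y -> vle y z -> vle x z ;
  vle_sup : forall x y z, vle (vsup x y) z <-> vle x z /\ vle y z ;
  vle_inf : forall x y z, vle z (vinf x y) <-> vle z x /\ vle z y ;
  vle_addr : forall x y z, vle x y -> vle (x + z) (y + z) ;
  vle_scale : forall (a : R) x y, 0 <= a -> vle x y -> vle (a *: x) (a *: y) ;
  vle_norm : forall x y, vle (vsup x (- x)) (vsup y (- y)) -> `|x| <= `|y|
}.

#[short(type="banachLatticeType")]
HB.structure Definition BanachLattice (R : realType) :=
  {E of isBanachLattice R E & CompleteNormedModule R E}.

Notation "x <=L y" := (vle x y) (at level 70, no associativity).

Section BanachLatticeNotions.
Variables (R : realType) (E : banachLatticeType R).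

Definition labs (x : E) : E := vsup x (- x).

Definition disjoint_seq (x : nat -> E) :=
  forall n m, n <> m -> vinf (labs (x n)) (labs (x m)) = 0.

Definition dedekind_complete :=
  forall A : set E, A !=set0 -> (exists u, forall x, A x -> x <=L u) ->
    exists s, (forall x, A x -> x <=L s) /\
              (forall u, (forall x, A x -> x <=L u) -> s <=L u).

End BanachLatticeNotions.
Arguments dedekind_complete {R} E.

Section BoundedOperators.
Variables (R : realType) (V W : normedModType R).

Definition bounded_operator (T : V -> W) :=
  linear T /\ exists M : R, forall x, `|T x| <= M * `|x|.

Definition opnorm (T : V -> W) : R :=
  sup [set `|T x| | x in [set x : V | `|x| <= 1]].

Lemma bounded_operator_submod :
  submod_closed [pred T : V -> W | `[< bounded_operator T >]].
Proof.
split=> [|a f g]; rewrite !inE.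
  have E0 x : (0 : V -> W) x = 0 by [].
  split=> [a x y|]; first by rewrite !E0 scaler0 addr0.
  by exists 0 => x; rewrite E0 normr0 mul0r.
have E x : (a *: f + g) x = a *: f x + g x by [].
move=> [lf [M Mf]] [lg [N Ng]]; split.
  move=> b x y; rewrite !E lf lg !scalerDr !scalerA (mulrC a b).
  by rewrite addrACA.
exists (`|a| * M + N) => x; rewrite E (le_trans (ler_normD _ _))//.
by rewrite mulrDl lerD// normrZ -mulrA ler_wpM2l.
Qed.

Lemma opnorm_has_sup (T : V -> W) : bounded_operator T ->
  has_sup [set `|T x| | x in [set x : V | `|x| <= 1]].
Proof.
move=> [_ [M TM]]; split; first by exists `|T 0|, 0 => //=; rewrite normr0.
exists `|M| => _ [x /= x1 <-]; rewrite (le_trans (TM x))//.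
rewrite (le_trans (ler_norm _))// normrM normr_id.
by rewrite -[leRHS]mulr1 ler_wpM2l.
Qed.

Lemma le_opnorm1 (T : V -> W) x : bounded_operator T -> `|x| <= 1 ->
  `|T x| <= opnorm T.
Proof. by move=> /opnorm_has_sup[_ uT] x1; apply: ub_le_sup => //; exists x. Qed.

Lemma opnorm_le (T : V -> W) (c : R) : bounded_operator T ->
  (forall x, `|x| <= 1 -> `|T x| <= c) -> opnorm T <= c.
Proof.
move=> /opnorm_has_sup[T0 _] Tc.
by apply: ge_sup => // _ [x /= x1 <-]; exact: Tc.
Qed.

End BoundedOperators.

Section Dual.
Variables (R : realType) (Y : normedModType R).

Definition bounded_functional : {pred (Y -> R^o)} :=
  [pred f : Y -> R^o | `[< bounded_operator f >]].

HB.instance Definition _ :=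
  GRing.isSubmodClosed.Build R (Y -> R^o) bounded_functional
    (@bounded_operator_submod R Y R^o).

(* The norm dual, with the operator norm. *)
Record dual := Dual {
  dual_fun :> Y -> R^o ;
  _ : dual_fun \in bounded_functional }.

HB.instance Definition _ := [isSub for dual_fun].
HB.instance Definition _ := [Choice of dual by <:].
HB.instance Definition _ := [SubChoice_isSubLmodule of dual by <:].

Lemma dual_bounded (f : dual) : bounded_operator f.
Proof. by case: f => f /= /asboolP. Qed.

Definition dual_norm (f : dual) : R := opnorm f.

Lemma dual_normD f g : dual_norm (f + g) <= dual_norm f + dual_norm g.
Proof.
apply: opnorm_le => [|x x1]; first exact: dual_bounded.
rewrite (_ : (f + g) x = f x + g x)// (le_trans (ler_normD _ _))//.
by rewrite lerD// le_opnorm1//; exact: dual_bounded.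
Qed.

Lemma dual_normZ_le a f : dual_norm (a *: f) <= `|a| * dual_norm f.
Proof.
apply: opnorm_le => [|x x1]; first exact: dual_bounded.
rewrite (_ : (a *: f) x = a *: f x)// normrZ ler_wpM2l//.
by rewrite le_opnorm1//; exact: dual_bounded.
Qed.

Lemma dual_normZ a f : dual_norm (a *: f) = `|a| * dual_norm f.
Proof.
apply/le_anti; rewrite dual_normZ_le/=.
have [->|a0] := eqVneq a 0.
  rewrite normr0 mul0r (le_trans (normr_ge0 ((0 *: f) 0)))//.
  by rewrite le_opnorm1 ?normr0//; exact: dual_bounded.
have := dual_normZ_le a^-1 (a *: f).
by rewrite scalerA mulVf// scale1r normfV ler_pdivlMl ?normr_gt0.
Qed.

Lemma dual_norm0_eq0 f : dual_norm f = 0 -> f = 0.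
Proof.
move=> f0; apply/val_inj/funext => x /=; rewrite -[RHS]/(0 : R^o).
have [lf _] := dual_bounded f.
have fZ a y : f (a *: y) = a *: f y.
  by have := lf a y 0; have := lf (-1) 0 0; rewrite !addr0 scaleN1r oppr0
     scaleN1r addNr => ->; rewrite addr0.
have [->|x0] := eqVneq x 0.
  by have := fZ 0 0; rewrite !scale0r.
have : `|f (`|x|^-1 *: x)| <= 0.
  rewrite -f0 le_opnorm1//; first exact: dual_bounded.
  by rewrite normrZ normfV normr_id mulVf// normr_eq0.
rewrite normr_le0 fZ scaler_eq0 invr_eq0 normr_eq0 (negPf x0)/=.
by move/eqP.
Qed.

HB.instance Definition _ :=
  Lmodule_isNormed.Build R dual dual_normD dual_normZ dual_norm0_eq0.

Definition weakly_cvg (u : nat -> Y) (y : Y) :=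
  forall f : dual, f (u n) @[n --> \oo] --> f y.

End Dual.

Section AlmostMW.
Variables (R : realType) (E : banachLatticeType R) (Y : completeNormedModType R).

Definition aMW : set (E -> Y) := [set S |
  bounded_operator S /\
  forall (x : nat -> E) (f : nat -> dual Y),
    disjoint_seq x -> bounded_fun x -> (exists g, weakly_cvg f g) ->
    f n (S (x n)) @[n --> \oo] --> (0 : R)].

End AlmostMW.
Arguments aMW {R} E Y.

Section RegularOperators.
Variables (R : realType) (E : banachLatticeType R).
Implicit Types (S T V : E -> E) (A L : set (E -> E)).

Definition positive_operator T :=
  linear T /\ forall x : E, 0 <=L x -> 0 <=L T x.

Definition op_le S T := positive_operator (T - S).

Definition regular_operators : set (E -> E) := [set T |
  exists T1 T2, [/\ positive_operator T1, positive_operator T2 & T = T1 - T2]].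

Definition regular_aMW : set (E -> E) := [set T |
  exists T1 T2, [/\ positive_operator T1 /\ aMW E E T1,
                    positive_operator T2 /\ aMW E E T2 & T = T1 - T2]].

(* The dominating operators [S] satisfy [0 <= 2 S], hence are positive, and so
   bounded because E is a Banach lattice: [opnorm S] is a genuine supremum. *)
Definition regular_norm T : R :=
  inf [set opnorm S | S in [set S | [/\ linear S, op_le T S & op_le (- T) S]]].

Definition regular_aMW_norm T : R :=
  inf [set opnorm S | S in [set S | [/\ aMW E E S, op_le T S & op_le (- T) S]]].

Definition linear_subspace A L :=
  [/\ A `<=` L, A 0, (forall S T, A S -> A T -> A (S + T))
    & forall (a : R) T, A T -> A (a *: T)].

(* Subalgebras are not required to contain the identity. *)
Definition subalgebra A L :=
  linear_subspace A L /\ forall S T, A S -> A T -> A (S \o T).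

Definition op_sup L S T V :=
  [/\ L V, op_le S V, op_le T V &
    forall W, L W -> op_le S W -> op_le T W -> op_le V W].

Definition op_inf L S T V :=
  [/\ L V, op_le V S, op_le V T &
    forall W, L W -> op_le W S -> op_le W T -> op_le W V].

(* Suprema and infima are those of the ambient space [L], and are required to
   exist. *)
Definition vector_sublattice A L :=
  linear_subspace A L /\
  forall S T, A S -> A T ->
    (exists2 V, op_sup L S T V & A V) /\ (exists2 V, op_inf L S T V & A V).

Definition riesz_subalgebra A L := subalgebra A L /\ vector_sublattice A L.

Definition op_modulus L T V := op_sup L T (- T) V.

Definition order_ideal A L :=
  linear_subspace A L /\
  forall S T absS absT, L S -> A T ->
    op_modulus L S absS -> op_modulus L T absT -> op_le absS absT -> A S.

Definition regular_norm_closed A :=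
  forall T, regular_operators T ->
    (forall e : R, 0 < e -> exists2 S, A S & regular_norm (T - S) < e) -> A T.

End RegularOperators.
Arguments regular_operators {R} E.
Arguments regular_aMW {R} E.

(* Main.v *)
Require Import Defs.
From HB Require Import structures.
From mathcomp Require Import all_boot all_order all_algebra.
From mathcomp Require Import lra.
From mathcomp Require Import all_classical all_reals all_analysis.

(** Why the theorem is true.

    Almost MW-operators form a left ideal: if [T] is almost MW and [S] is
    bounded, then [f (S (T x)) = (S' f) (T x)], and the adjoint [S'] is
    weak-to-weak continuous ([aMW_comp]).  Positive operators on a Banach
    lattice are bounded ([monotone_bounded]), so part (i) follows: products of
    differences expand into products of positive operators, and
    [T = T \o idfun] when the identity is almost MW.

    Part (ii) rests on domination: if [0 <= S <= T] and [T] is almost MW, then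
    so is [S].  The inequality [`|f (S x)| <= |f| (T |x|)] reduces it to
    [|f_n| (T x_n) --> 0] for positive disjoint bounded [x_n], which is not a
    formal consequence of [f_n (T x_n) --> 0] because [|f_n|] need not be weakly
    convergent ([aMW_positive_part_null]).  Writing [y_n = T x_n] and
    [h_n = f_n^+], suppose that [h_n y_n >= e].  The constant sequence [f] shows
    that [y_n] is weakly null, so along a subsequence each [h_i y_n] with [i < n]
    is as small as one likes.  Then

      [g_n = (h_n - 4^n * \sum_(i < n) h_i - 2^-n * F)^+],
      [F = \sum_i 2^-i h_i],

    still satisfies [g_n y_n >= e / 2] for large [n], while the [g_n] are
    pairwise disjoint in the dual and [0 <= g_n <= f_n^+].  A disjoint sequence
    in the solid hull of a weakly convergent sequence is weakly null
    ([disjoint_weakly_null]), so [g_n y_n --> 0] because [T] is almost MW: a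
    contradiction.

    For the weak nullity of [g_n], let [phi >= 0] be in the bidual and let
    [phi_n] be its restriction to the band generated by [g_n].  Then
    [\sum_n |phi_n h| <= phi |h|], and [phi_n f_n >= phi g_n] since [f_n^-] is
    disjoint from [g_n].  So [f |-> (phi_n f)_n] maps the dual into l1, where
    weak and norm convergence of sequences agree, whence [phi_n f_n --> 0]
    ([gliding_hump]).

    When [E] is Dedekind complete, every regular operator has a positive part,
    by the Riesz--Kantorovich formula, and hence a least majorant of [T] and
    [- T].  Sublattice, ideal and equality of the norms follow by dominating
    these operators by sums of positive almost MW-operators.  For closedness,
    the majorant [V] of an approximant [S] and an operator [U] of small norm with
    [- U <= T - S <= U] give [|T| <= V + U], and the argument for domination
    tolerates the error [U] ([aMW_approx]). *)

Set Implicit Arguments.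
Unset Strict Implicit.
Unset Printing Implicit Defensive.

Import Order.TTheory GRing.Theory Num.Theory.
Import numFieldNormedType.Exports.

Local Open Scope classical_set_scope.
Local Open Scope ring_scope.

(** * Riesz spaces *)

(** The order-theoretic part of a Banach lattice, isolated so that it can also be
    used for the real line and for the dual, whose order is only constructed
    below. *)
HB.mixin Record isRiesz (R : realType) V of GRing.Lmodule R V := {
  rle : V -> V -> Prop ;
  rsup : V -> V -> V ;
  rle_refl : forall x, rle x x ;
  rle_anti : forall x y, rle x y -> rle y x -> x = y ;
  rle_trans : forall y x z, rle x y -> rle y z -> rle x z ;
  rsup_le : forall x y z, rle (rsup x y) z <-> rle x z /\ rle y z ;
  rle_addr : forall x y z, rle x y -> rle (x + z) (y + z) ;
  rle_scale : forall (a : R) x y, 0 <= a -> rle x y -> rle (a *: x) (a *: y)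
}.

#[short(type="rieszType")]
HB.structure Definition Riesz (R : realType) :=
  {V of isRiesz R V & GRing.Lmodule R V}.

Notation "x <=V y" := (rle x y) (at level 70, no associativity).

(** Riesz spaces enter after Banach lattices, so the inheritance is declared on
    the carrier of the latter. *)
#[non_forgetful_inheritance]
HB.instance Definition _ (R : realType) (E : banachLatticeType R) :=
  isRiesz.Build R E (@vle_refl R E) (@vle_anti R E) (@vle_trans R E)
    (@vle_sup R E) (@vle_addr R E) (@vle_scale R E).


Section RieszTheory.
Variables (R : realType) (V : rieszType R).
Implicit Types (x y z u v w : V) (a : R).

Definition rpos x := rsup x 0.
Definition rinf x y := - rsup (- x) (- y).
Definition rabs x := rpos x + rpos (- x).

Lemma rle_add x y u v : x <=V y -> u <=V v -> x + u <=V y + v.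
Proof.
move=> xy uv; apply: (@rle_trans _ _ (y + u)); first exact: rle_addr.
by rewrite ![y + _]addrC; exact: rle_addr.
Qed.

Lemma rle_subr x y z : x + y <=V z <-> x <=V z - y.
Proof.
by split=> [/(rle_addr _ _ (- y))|/(rle_addr _ _ y)]; rewrite ?addrK ?subrK.
Qed.

Lemma rle_sub x y : x <=V y <-> 0 <=V y - x.
Proof. by rewrite -{1}(add0r x); exact: rle_subr. Qed.

Lemma rle_opp x y : x <=V y <-> - y <=V - x.
Proof. by rewrite rle_sub [in X in _ <-> X]rle_sub opprK addrC. Qed.

Lemma radd_ge0 x y : 0 <=V x -> 0 <=V y -> 0 <=V x + y.
Proof. by move=> x0 y0; rewrite -[0]addr0; exact: rle_add. Qed.

Lemma rscale_ge0 a x : 0 <= a -> 0 <=V x -> 0 <=V a *: x.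
Proof. by move=> a0 x0; rewrite -(scaler0 _ a); exact: rle_scale. Qed.

Lemma rle_scalel a b x : a <= b -> 0 <=V x -> a *: x <=V b *: x.
Proof.
by move=> ab x0; apply/rle_sub; rewrite -scalerBl; apply: rscale_ge0 => //;
  rewrite subr_ge0.
Qed.

Lemma rle_scaleV a x y : 0 < a -> a *: x <=V y <-> x <=V a^-1 *: y.
Proof.
move=> a0; have aN0 : a != 0 by rewrite gt_eqF.
split=> h.
  rewrite -[x]scale1r -(mulVf aN0) -scalerA.
  by apply: rle_scale => //; rewrite invr_ge0 ltW.
by rewrite -[y]scale1r -(mulfV aN0) -scalerA; apply: rle_scale => //;
  exact: ltW.
Qed.

Lemma rsum_ge0 (I : Type) (s : seq I) (P : pred I) (f : I -> V) :
  (forall i, P i -> 0 <=V f i) -> 0 <=V \sum_(i <- s | P i) f i.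
Proof.
by move=> f0; elim/big_ind: _ => //; [exact: rle_refl|exact: radd_ge0].
Qed.

Lemma rle_supl x y : x <=V rsup x y.
Proof. by have [] := (rsup_le x y (rsup x y)).1 (rle_refl _). Qed.

Lemma rle_supr x y : y <=V rsup x y.
Proof. by have [] := (rsup_le x y (rsup x y)).1 (rle_refl _). Qed.

Lemma rinf_ge x y z : z <=V rinf x y <-> z <=V x /\ z <=V y.
Proof.
by rewrite rle_opp opprK rsup_le -!rle_opp.
Qed.

Lemma rinf_lel x y : rinf x y <=V x.
Proof. by have [] := (rinf_ge x y (rinf x y)).1 (rle_refl _). Qed.

Lemma rinf_ler x y : rinf x y <=V y.
Proof. by have [] := (rinf_ge x y (rinf x y)).1 (rle_refl _). Qed.

Lemma rinfC x y : rinf x y = rinf y x.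
Proof.
by apply: rle_anti; apply/rinf_ge; split;
  do [exact: rinf_ler|exact: rinf_lel].
Qed.

Lemma rinf_mono x y u v : x <=V u -> y <=V v -> rinf x y <=V rinf u v.
Proof.
move=> xu yv; apply/rinf_ge; split.
  by apply: rle_trans xu; exact: rinf_lel.
by apply: rle_trans yv; exact: rinf_ler.
Qed.

Lemma rinf_ge0 x y : 0 <=V x -> 0 <=V y -> 0 <=V rinf x y.
Proof. by move=> x0 y0; apply/rinf_ge. Qed.

Lemma rsupDr x y z : rsup x y + z = rsup (x + z) (y + z).
Proof.
apply: rle_anti.
  apply/rle_subr/rsup_le; split; apply/rle_subr;
    [exact: rle_supl|exact: rle_supr].
by apply/rsup_le; split; apply: rle_addr; [exact: rle_supl|exact: rle_supr].
Qed.

Lemma rinfDr x y z : rinf x y + z = rinf (x + z) (y + z).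
Proof.
by rewrite /rinf !opprD -rsupDr opprD opprK.
Qed.

Lemma rinfZ a x y : 0 < a -> rinf (a *: x) (a *: y) = a *: rinf x y.
Proof.
move=> a0; have ai0 : 0 < a^-1 by rewrite invr_gt0.
apply: rle_anti.
  rewrite -[a in X in _ <=V X]invrK; apply/(rle_scaleV _ _ ai0)/rinf_ge.
  by split; apply/(rle_scaleV _ _ ai0); rewrite invrK;
    [exact: rinf_lel|exact: rinf_ler].
by apply/rinf_ge; split; apply: rle_scale; rewrite ?ltW//;
  [exact: rinf_lel|exact: rinf_ler].
Qed.

Lemma rpos_ge0 x : 0 <=V rpos x.
Proof. exact: rle_supr. Qed.

Lemma rle_pos x : x <=V rpos x.
Proof. exact: rle_supl. Qed.

Lemma rpos_le x u : x <=V u -> 0 <=V u -> rpos x <=V u.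
Proof. by move=> xu u0; apply/rsup_le. Qed.

Lemma rpos_mono x y : x <=V y -> rpos x <=V rpos y.
Proof.
by move=> xy; apply: rpos_le (rpos_ge0 _); apply: rle_trans xy (rle_pos _).
Qed.

Lemma rpos_id x : 0 <=V x -> rpos x = x.
Proof.
move=> x0; apply: rle_anti; last exact: rle_pos.
by apply: rpos_le => //; exact: rle_refl.
Qed.

Lemma rposN_id x : 0 <=V x -> rpos (- x) = 0.
Proof.
move=> x0; apply: rle_anti; last exact: rpos_ge0.
by apply: rpos_le; [rewrite -oppr0; apply/rle_opp;
  rewrite !opprK|exact: rle_refl].
Qed.

Lemma rpos_sub x : x = rpos x - rpos (- x).
Proof.
apply/eqP; rewrite eq_sym subr_eq; apply/eqP.
by rewrite addrC /rpos rsupDr addNr add0r; apply: rle_anti; apply/rsup_le;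
  split;
  do [exact: rle_supl|exact: rle_supr].
Qed.

Lemma rposZ a x : 0 < a -> rpos (a *: x) = a *: rpos x.
Proof.
move=> a0; have ai0 : 0 < a^-1 by rewrite invr_gt0.
apply: rle_anti.
  by apply: rpos_le; [apply: rle_scale (rle_pos _)|apply: rscale_ge0 (rpos_ge0 _)]; exact: ltW.
apply/(rle_scaleV _ _ a0)/rpos_le.
  by apply/(rle_scaleV _ _ a0)/rle_pos.
by apply: rscale_ge0 (rpos_ge0 _); exact: ltW.
Qed.

Lemma rinf_pos_neg x : rinf (rpos x) (rpos (- x)) = 0.
Proof.
have e : rpos (- x) = - x + rpos x.
  have := congr1 (fun z => z + rpos (- x)) (rpos_sub x).
  by rewrite subrK => <-; rewrite addKr.
rewrite e -{1}[rpos x]add0r -rinfDr /rinf oppr0 opprK.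
rewrite addrC; apply/eqP; rewrite subr_eq0; apply/eqP.
by apply: rle_anti; apply/rsup_le; split; do [exact: rle_supl|exact: rle_supr].
Qed.

Lemma rabs_ge0 x : 0 <=V rabs x.
Proof. by apply: radd_ge0; exact: rpos_ge0. Qed.

Lemma rle_abs x : x <=V rabs x.
Proof.
rewrite -[X in X <=V _]addr0; apply: rle_add; [exact: rle_pos|exact: rpos_ge0].
Qed.

Lemma rabsN x : rabs (- x) = rabs x.
Proof. by rewrite /rabs opprK addrC. Qed.

Lemma rabs_id x : 0 <=V x -> rabs x = x.
Proof. by move=> x0; rewrite /rabs rpos_id// rposN_id// addr0. Qed.

Lemma rabs_le x u : x <=V u -> - x <=V u -> rabs x <=V u.
Proof.
move=> xu Nxu.
have -> : rabs x = 2 *: rpos x - x.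
  by rewrite /rabs scaler_nat mulr2n [X in _ - X]rpos_sub opprB addrACA subrr addr0.
apply/rle_subr; rewrite opprK addrC.
rewrite -rposZ//; apply: rpos_le; last by rewrite addrC -[x]opprK -rle_sub.
by rewrite scaler_nat mulr2n; apply: rle_add => //; exact: rle_refl.
Qed.

Lemma rpos_le_abs x : rpos x <=V rabs x.
Proof. by apply: rpos_le; [exact: rle_abs|exact: rabs_ge0]. Qed.

Lemma riesz_decomposition x y z : 0 <=V x -> 0 <=V y -> 0 <=V z ->
  z <=V x + y ->
  exists z1 z2, [/\ 0 <=V z1 /\ z1 <=V x, 0 <=V z2 /\ z2 <=V y & z = z1 + z2].
Proof.
move=> x0 y0 z0 zxy; exists (rinf z x), (z - rinf z x); split.
- by split; [exact: rinf_ge0|exact: rinf_ler].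
- split; first by rewrite -rle_sub; exact: rinf_lel.
  have zi : z <=V rinf z x + y.
    rewrite rinfDr; apply/rinf_ge; split => //.
    by rewrite -[X in X <=V _]addr0; apply: rle_add => //; exact: rle_refl.
  by have := rle_addr _ _ (- rinf z x) zi; rewrite [_ + y]addrC addrK.
- by rewrite addrC subrK.
Qed.

Lemma rinfD_le x y z : 0 <=V x -> 0 <=V y -> 0 <=V z ->
  rinf (x + y) z <=V rinf x z + rinf y z.
Proof.
move=> x0 y0 z0; rewrite rinfDr; apply/rinf_ge; split.
  rewrite [X in _ <=V X]addrC rinfDr; apply/rinf_ge; split.
    by rewrite [X in _ <=V X]addrC; exact: rinf_lel.
  by apply: rle_trans (rinf_ler _ _) _; rewrite -{1}[z]addr0;
    apply: rle_add => //; exact: rle_refl.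
apply: rle_trans (rinf_ler _ _) _; rewrite -{1}[z]addr0.
by apply: rle_add; [exact: rle_refl|exact: rinf_ge0].
Qed.

Lemma rinfD_ge x y z : rinf x z + rinf y z <=V rinf (x + y) (2 *: z).
Proof.
apply/rinf_ge; split.
  by apply: rle_add; exact: rinf_lel.
by rewrite scaler_nat mulr2n; apply: rle_add; exact: rinf_ler.
Qed.

Lemma rinf0_mono x y u v : 0 <=V u -> 0 <=V v -> u <=V x -> v <=V y ->
  rinf x y = 0 -> rinf u v = 0.
Proof.
move=> u0 v0 ux vy xy; apply: rle_anti; last exact: rinf_ge0.
by rewrite -xy; exact: rinf_mono.
Qed.

Lemma rinf0D x y z : 0 <=V x -> 0 <=V y -> 0 <=V z ->
  rinf x z = 0 -> rinf y z = 0 -> rinf (x + y) z = 0.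
Proof.
move=> x0 y0 z0 xz yz; apply: rle_anti; last by apply: rinf_ge0 => //;
  exact: radd_ge0.
by apply: rle_trans (rinfD_le x0 y0 z0) _; rewrite xz yz addr0; exact: rle_refl.
Qed.

Lemma rinf0_add_le x y u : rinf x y = 0 -> x <=V u -> y <=V u -> x + y <=V u.
Proof.
move=> xy xu yu; have : rinf x y + (u - x - y) = u - x - y by rewrite xy add0r.
rewrite rinfDr => e; rewrite rle_sub opprD addrA -e; apply/rinf_ge; split.
  by rewrite addrA [x + _]addrC subrK -rle_sub.
by rewrite addrC subrK -rle_sub.
Qed.

(** Disjoint summands add up to their supremum. *)
Lemma rinf_sum_disjoint_le (g : nat -> V) (h : V) (a : R) (N : nat) :
  0 < a -> 0 <=V h -> (forall n, 0 <=V g n) ->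
  (forall n m, (n < m)%N -> rinf (g n) (g m) = 0) ->
  \sum_(n < N) rinf h (a *: g n) <=V h.
Proof.
move=> a0 h0 g0 gdisj; have ag0 n : 0 <=V a *: g n by apply: rscale_ge0 => //;
  exact: ltW.
have s0 M : 0 <=V \sum_(n < M) rinf h (a *: g n).
  by apply: rsum_ge0 => i _; exact: rinf_ge0.
elim: N => [|N IH]; first by rewrite big_ord0.
rewrite big_ord_recr/=; apply: rinf0_add_le => //; last exact: rinf_lel.
apply: (rinf0_mono (x := \sum_(n < N) rinf h (a *: g n)) (y := a *: g N)).
- exact: s0.
- exact: rinf_ge0.
- exact: rle_refl.
- exact: rinf_ler.
suff: forall M, (M <= N)%N ->
  rinf (\sum_(n < M) rinf h (a *: g n)) (a *: g N) = 0 by apply.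
elim=> [|M IHM] MN.
  by rewrite big_ord0; apply: rle_anti;
    [exact: rinf_lel|apply: rinf_ge0 => //; exact: rle_refl].
rewrite big_ord_recr/=; apply: rinf0D;
  [exact: s0|exact: rinf_ge0|exact: ag0| |].
  by apply: IHM; exact: ltnW.
apply: (rinf0_mono (x := a *: g M) (y := a *: g N)).
- exact: rinf_ge0.
- exact: ag0.
- exact: rinf_ler.
- exact: rle_refl.
- by rewrite rinfZ// gdisj// scaler0.
Qed.

(** If [w] lies below both, then [w <= (x - a y)^+], and
    [y - b x <= a^-1 (a y - x)] gives [w <= a^-1 (x - a y)^-].  The two parts of
    a vector are disjoint. *)
Lemma rinf_pos_sub0 x y a b : 0 <=V x -> 0 < a -> 1 <= a * b ->
  rinf (rpos (x - a *: y)) (rpos (y - b *: x)) = 0.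
Proof.
move=> x0 a0 ab; have ai0 : 0 < a^-1 by rewrite invr_gt0.
set t := x - a *: y; set k := 1 + a^-1.
have k0 : 0 < k by rewrite ltr_pwDl// ltW.
apply: (rinf0_mono (x := k *: rpos t) (y := k *: rpos (- t))).
- exact: rpos_ge0.
- exact: rpos_ge0.
- rewrite -[X in X <=V _]scale1r; apply: rle_scalel; last exact: rpos_ge0.
  by rewrite lerDl ltW.
- apply: (@rle_trans _ _ (a^-1 *: rpos (- t))); last first.
    by apply: rle_scalel; [rewrite lerDr|exact: rpos_ge0].
  rewrite -rposZ//; apply: rpos_mono.
  rewrite /t opprB scalerBr scalerA mulVf ?gt_eqF// scale1r.
  apply: rle_add; first exact: rle_refl.
  rewrite -rle_opp; apply: rle_scalel => //.
  by rewrite -[a^-1]mulr1 ler_pdivrMl.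
- by rewrite rinfZ// rinf_pos_neg scaler0.
Qed.
End RieszTheory.

(** * Linear maps between Riesz spaces *)

Section LinearMaps.
Variables (R : realType) (V W : lmodType R).
Implicit Types (T S : V -> W).

Lemma lin0 T : linear T -> T 0 = 0.
Proof. by move=> lT; have := lT (-1) 0 0;
  rewrite scaler0 addr0 scaleN1r addNr. Qed.

Lemma linZ T a x : linear T -> T (a *: x) = a *: T x.
Proof. by move=> lT; have := lT a x 0; rewrite (lin0 lT) !addr0. Qed.

Lemma linD T x y : linear T -> T (x + y) = T x + T y.
Proof. by move=> lT; have := lT 1 x y; rewrite !scale1r. Qed.

Lemma linN T x : linear T -> T (- x) = - T x.
Proof. by move=> lT; rewrite -scaleN1r linZ// scaleN1r. Qed.

Lemma linB T x y : linear T -> T (x - y) = T x - T y.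
Proof. by move=> lT; rewrite linD// linN. Qed.

Lemma linear_add T S : linear T -> linear S -> linear (T + S).
Proof.
move=> lT lS a x y.
by rewrite !(_ : forall z, (T + S) z = T z + S z)// lT lS scalerDr addrACA.
Qed.

Lemma linear_scale a T : linear T -> linear (a *: T).
Proof.
move=> lT b x y.
by rewrite !(_ : forall z, (a *: T) z = a *: T z)// lT scalerDr !scalerA mulrC.
Qed.

Lemma linear_opp T : linear T -> linear (- T).
Proof. by move=> lT; rewrite -scaleN1r; exact: linear_scale. Qed.

Lemma linear_sub T S : linear T -> linear S -> linear (T - S).
Proof. by move=> lT lS; apply: linear_add => //; exact: linear_opp. Qed.

End LinearMaps.

Lemma linear_comp (R : realType) (U V W : lmodType R) (S : V -> W) (T : U ->
  V) :
  linear S -> linear T -> linear (S \o T).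
Proof. by move=> lS lT a x y /=; rewrite lT lS. Qed.


Section RealLine.
Variable R : realType.
Implicit Types x y z : R^o.

Let real_anti x y : (x <= y)%R -> (y <= x)%R -> x = y.
Proof. by move=> xy yx; apply/le_anti/andP. Qed.

Let real_sup_le x y z : (Num.max x y <= z)%R <-> (x <= z)%R /\ (y <= z)%R.
Proof. by rewrite ge_max; split=> [/andP[]|[-> ->]]. Qed.

Let real_le_addr x y z : (x <= y)%R -> (x + z <= y + z)%R.
Proof. by rewrite lerD2r. Qed.

Let real_le_scale (a : R) x y : (0 <= a)%R -> (x <= y)%R ->
  (a *: x <= a *: y)%R.
Proof. by move=> a0 xy; exact: ler_wpM2l. Qed.

HB.instance Definition _ :=
  isRiesz.Build R R^o (@lexx _ R) real_anti (fun y x z => @le_trans _ R y x z)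
    real_sup_le real_le_addr real_le_scale.
End RealLine.

Definition order_complete (R : realType) (V : rieszType R) :=
  forall A : set V, A !=set0 -> (exists u, forall x, A x -> x <=V u) ->
    exists s, (forall x, A x -> x <=V s) /\
              (forall u, (forall x, A x -> x <=V u) -> s <=V u).

Lemma real_order_complete (R : realType) : order_complete R^o.
Proof.
move=> A A0 [u Au]; exists (sup (A : set R)); split.
  by move=> x Ax; apply: ub_le_sup Ax; exists u.
by move=> v Av; apply: ge_sup.
Qed.

Lemma real_rabs (R : realType) (x : R^o) : rabs x = `|x|.
Proof.
have [x0|/ltW x0] := leP 0 x; first by rewrite rabs_id// ger0_norm.
rewrite -rabsN rabs_id ?ler0_norm//.
by have : (0 <= - x)%R by rewrite oppr_ge0.
Qed.

Section ConeExtension.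
Variables (R : realType) (V : rieszType R) (W : lmodType R).
Implicit Types (x y z : V) (p : V -> W).

(** An additive and positively homogeneous map on the positive cone extends to
    the linear map [x |-> p x^+ - p x^-]. *)
Definition cone_ext p x := p (rpos x) - p (rpos (- x)).

Definition cone_additive p := forall x y, 0 <=V x -> 0 <=V y ->
  p (x + y) = p x + p y.
Definition cone_homogeneous p :=
  forall (a : R) x, 0 < a -> 0 <=V x -> p (a *: x) = a *: p x.

(** Well-definedness: the extension can be computed from any decomposition of a
    vector as a difference of positive ones, which yields its additivity. *)
Lemma cone_ext_sub p x y : cone_additive p -> 0 <=V x -> 0 <=V y ->
  cone_ext p (x - y) = p x - p y.
Proof.
move=> pD x0 y0; rewrite /cone_ext; set u := rpos _; set v := rpos _.
have e : u + y = x + v.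
  have := rpos_sub (x - y); rewrite -/u -/v => /(congr1 (fun z => z + v + y)).
  by rewrite subrK => <-; rewrite addrAC subrK.
have u0 : 0 <=V u by exact: rpos_ge0.
have v0 : 0 <=V v by exact: rpos_ge0.
have := congr1 p e; rewrite !pD// => pe.
apply/eqP; rewrite subr_eq addrAC eq_sym subr_eq; exact/eqP.
Qed.

Lemma cone_ext_pos p x : cone_additive p -> 0 <=V x -> cone_ext p x = p x.
Proof.
move=> pD x0; have p0 : p 0 = 0.
  have := pD 0 0 (rle_refl _) (rle_refl _); rewrite addr0.
  by move/(congr1 (fun w => w - p 0)); rewrite addrK subrr.
by rewrite -{1}[x]subr0 cone_ext_sub ?p0 ?subr0//; exact: rle_refl.
Qed.

Lemma cone_ext_linear p : cone_additive p -> cone_homogeneous p ->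
  linear (cone_ext p).
Proof.
move=> pD pZ.
have D x y : cone_ext p (x + y) = cone_ext p x + cone_ext p y.
  rewrite {1}[x]rpos_sub {1}[y]rpos_sub addrACA -opprD.
  rewrite cone_ext_sub//; try by apply: radd_ge0; exact: rpos_ge0.
  by rewrite !pD; try exact: rpos_ge0; rewrite opprD addrACA.
have N x : cone_ext p (- x) = - cone_ext p x.
  by rewrite /cone_ext opprK opprB.
have p0 : cone_ext p 0 = 0 by rewrite /cone_ext oppr0 subrr.
have Zp a x : 0 < a -> cone_ext p (a *: x) = a *: cone_ext p x.
  move=> a0; rewrite /cone_ext -scalerN !rposZ// !pZ ?scalerBr//;
    exact: rpos_ge0.
move=> a x y; rewrite D; congr (_ + _).
have [a0|a0|->] := ltgtP a 0; last by rewrite !scale0r p0.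
  by have := Zp (- a) x; rewrite oppr_gt0 => /(_ a0);
    rewrite !scaleNr N => /oppr_inj.
exact: Zp.
Qed.

End ConeExtension.

Lemma positive_mono (R : realType) (V W : rieszType R) (T : V -> W) x y :
  linear T -> (forall x, 0 <=V x -> 0 <=V T x) -> x <=V y -> T x <=V T y.
Proof. by move=> lT T0 xy; rewrite rle_sub -linB//; apply: T0;
  rewrite -rle_sub. Qed.

Lemma positive_abs_le (R : realType) (V W : rieszType R) (T : V -> W) x :
  linear T -> (forall x, 0 <=V x -> 0 <=V T x) -> rabs (T x) <=V T (rabs x).
Proof.
move=> lT T0; apply: rabs_le; rewrite -?linN//; apply: positive_mono => //.
  exact: rle_abs.
by rewrite -rabsN; exact: rle_abs.
Qed.

Section RieszKantorovich.
Variables (R : realType) (V W : rieszType R).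

(** Riesz--Kantorovich formula: on the cone, [P x] is the supremum of
    [T z] over [0 <= z <= x].  Its additivity is the Riesz decomposition
    property of [V]. *)
Theorem riesz_kantorovich (T : V -> W) : order_complete W -> linear T ->
  (forall x, 0 <=V x -> exists u, forall z, 0 <=V z -> z <=V x -> T z <=V u) ->
  exists P : V -> W, linear P /\ forall x, 0 <=V x ->
    (forall z, 0 <=V z -> z <=V x -> T z <=V P x) /\
    (forall u, (forall z, 0 <=V z -> z <=V x -> T z <=V u) -> P x <=V u).
Proof.
move=> cW lT bT.
pose lub x s := 
    (forall z, 0 <=V z -> z <=V x -> T z <=V s) /\
    (forall u, (forall z, 0 <=V z -> z <=V x -> T z <=V u) -> s <=V u).
have /choice[p pP] x : exists s, 0 <=V x -> lub x s.
  have [x0|x0] := pselect (0 <=V x); last by exists 0.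
  have [u Tu] := bT x x0.
  have [|| s [s1 s2]] := cW [set T z | z in [set z | 0 <=V z /\ z <=V x]].
  - by exists (T 0), 0 => //=; split => //; exact: rle_refl.
  - by exists u => _ [z /= [z0 zx] <-]; exact: Tu.
  exists s => _; split=> [z z0 zx|v Tv]; first by apply: s1; exists z.
  by apply: s2 => _ [z [z0 zx] <-]; exact: Tv.
have pD : cone_additive p.
  move=> x y x0 y0; have [x1 x2] := pP x x0; have [y1 y2] := pP y y0.
  have [xy1 xy2] := pP _ (radd_ge0 x0 y0); apply: rle_anti.
    apply: xy2 => z z0 zxy.
    have [z1 [z2 [[z10 z1x] [z20 z2y] ->]]] := riesz_decomposition x0 y0 z0 zxy.
    by rewrite linD//; apply: rle_add; [exact: x1|exact: y1].
  apply/rle_subr/x2 => z1 z10 z1x; apply/rle_subr.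
  rewrite addrC; apply/rle_subr/y2 => z2 z20 z2y; apply/rle_subr.
  rewrite addrC -linD//; apply: xy1; first exact: radd_ge0.
  exact: rle_add.
have pZ : cone_homogeneous p.
  have le a x : 0 < a -> 0 <=V x -> a *: p x <=V p (a *: x).
    move=> a0 x0; have [ax1 ax2] := pP _ (rscale_ge0 (ltW a0) x0).
    apply/rle_scaleV => //; apply: (pP x x0).2 => z z0 zx.
    apply/rle_scaleV => //; rewrite -linZ//; apply: ax1.
      by apply: rscale_ge0 => //; exact: ltW.
    by apply: rle_scale => //; exact: ltW.
  move=> a x a0 x0; apply: rle_anti; last exact: le.
  have ai0 : 0 < a^-1 by rewrite invr_gt0.
  rewrite -[a in X in _ <=V X]invrK; apply/rle_scaleV => //.
  have := le a^-1 (a *: x) ai0 (rscale_ge0 (ltW a0) x0).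
  by rewrite scalerA mulVf ?gt_eqF// scale1r.
exists (cone_ext p); split; first exact: cone_ext_linear.
by move=> x x0; rewrite cone_ext_pos//; exact: pP.
Qed.

End RieszKantorovich.

(** * The norm of a Banach lattice *)

Section BanachLatticeNorm.
Variables (R : realType) (E : banachLatticeType R).
Implicit Types x y z : E.

Lemma labsE x : labs x = rabs x.
Proof.
apply: rle_anti; last by apply: rabs_le; [exact: rle_supl|exact: rle_supr].
by apply/vle_sup; split; [exact: rle_abs|rewrite -rabsN; exact: rle_abs].
Qed.

Lemma norm_rabs_le x y : rabs x <=V rabs y -> `|x| <= `|y|.
Proof. by move=> xy; apply: vle_norm; rewrite -!/(labs _) !labsE. Qed.

Lemma norm_mono x y : 0 <=V x -> x <=V y -> `|x| <= `|y|.
Proof.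
move=> x0 xy; apply: norm_rabs_le; rewrite !rabs_id//.
exact: rle_trans xy.
Qed.

Lemma norm_rabs x : `|rabs x| = `|x|.
Proof.
by apply/le_anti/andP; split; apply: norm_rabs_le;
  rewrite [rabs (rabs x)]rabs_id; do ?[exact: rabs_ge0|exact: rle_refl].
Qed.

(** [(y - s)^+] is dominated by [|u N - s|], which becomes arbitrarily small in
    norm. *)
Lemma cone_closed (u : nat -> E) s y n : u @ \oo --> s ->
  (forall N, (n < N)%N -> y <=V u N) -> y <=V s.
Proof.
move=> us yu; suff e : rpos (y - s) = 0.
  by have := rle_pos (y - s); rewrite e => /(rle_addr _ _ s);
    rewrite subrK add0r.
apply/eqP; rewrite -normr_le0; apply/ler_addgt0Pr => e e0; rewrite add0r.
move/cvgrPdist_le : us => /(_ e e0)[N _ Ns].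
apply: le_trans (Ns (maxn N n.+1) (leq_maxl _ _)).
rewrite distrC -[leRHS]norm_rabs; apply: norm_mono; first exact: rpos_ge0.
apply: rpos_le (rabs_ge0 _); apply: rle_trans (rle_abs _).
by apply: rle_add (rle_refl _); apply: yu; rewrite leq_max ltnSn orbT.
Qed.

(** If [T] were unbounded, there would be positive [z n] with
    [`|z n| <= 2^-n] and [`|T (z n)| >= n].  Their sum dominates every [z n], so
    that [`|T (\sum_n z n)| >= n] for all [n].  Stated for norm-monotone maps, it
    covers positive operators and positive functionals at once. *)
Theorem monotone_bounded (W : normedModType R) (T : E -> W) : linear T ->
  (forall x y, 0 <=V x -> x <=V y -> `|T x| <= `|T y|) -> bounded_operator T.
Proof.
move=> lT Tm; split => //.
have [[M TM]|nb] := pselect (exists M : R, forall x, 0 <=V x -> `|x| <= 1 ->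
  `|T x| <= M).
  have Tp x : 0 <=V x -> `|T x| <= M * `|x|.
    move=> x0; have [->|xN0] := eqVneq x 0;
      first by rewrite lin0// !normr0 mulr0.
    have nx0 : 0 < `|x| by rewrite normr_gt0.
    have t0 : 0 <= `|x|^-1 by rewrite invr_ge0.
    have Tt : `|T (`|x|^-1 *: x)| = `|x|^-1 * `|T x|.
      by rewrite (linZ _ _ lT) normrZ ger0_norm.
    have := TM (`|x|^-1 *: x); rewrite Tt ler_pdivrMl// mulrC; apply.
      exact: rscale_ge0.
    by rewrite normrZ ger0_norm// mulVf// gt_eqF.
  exists (M + M) => x;
    rewrite {1}[x]rpos_sub linB// (le_trans (ler_normB _ _))//.
  rewrite mulrDl -norm_rabs; have ax0 := rabs_ge0 x.
  apply: lerD; apply: le_trans (Tp _ ax0); apply: Tm; try exact: rpos_ge0.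
    exact: rpos_le_abs.
  by rewrite -rabsN; exact: rpos_le_abs.
exfalso; have /choice[z zP] n : exists z : E,
    [/\ 0 <=V z, `|z| <= 2^-1 ^+ n & n%:R <= `|T z|].
  apply: contrapT => nz; apply: nb; exists (2 ^+ n * n%:R) => x x0 x1.
  rewrite leNgt; apply/negP => Tx; apply: nz; exists (2^-1 ^+ n *: x).
  have h0 : 0 <= 2^-1 ^+ n :> R by rewrite exprn_ge0.
  split; first exact: rscale_ge0.
    by rewrite normrZ ger0_norm// ler_piMr.
  by rewrite linZ// normrZ ger0_norm// exprVn ler_pdivlMl ?exprn_gt0// ltW.
have cz : cvgn (series z).
  apply: normed_cvg; apply: (@series_le_cvg _ _ (geometric 1 2^-1)) => //.
  - by move=> n /=; exact: normr_ge0.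
  - by move=> n; rewrite /geometric/= mul1r exprn_ge0.
  - by move=> n; rewrite /geometric/= mul1r; have [] := zP n.
  - by apply: is_cvg_geometric_series; rewrite ger0_norm// invf_lt1// ltr1n.
have zs n : z n <=V limn (series z).
  apply: (cone_closed (n := n) cz) => N nN.
  rewrite /series/= big_mkord (bigD1 (Ordinal nN))//= -[X in X <=V _]addr0.
  apply: rle_add (rle_refl _) _; apply: rsum_ge0 => i _.
  by have [] := zP i.
have := Tm (z (Num.truncn `|T (limn (series z))|).+1) _ _ (zs _).
have [z0 _ zT] := zP (Num.truncn `|T (limn (series z))|).+1.
move=> /(_ z0) /(le_trans zT); apply/negP; rewrite -ltNge.
exact: Num.Theory.truncnS_gt.
Qed.

Lemma positive_functional_bounded (f : E -> R^o) : linear f ->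
  (forall x, 0 <=V x -> 0 <= f x) -> bounded_operator f.
Proof.
move=> lf f0; apply: monotone_bounded => // x y x0 xy.
have fxy : f x <= f y.
  by rewrite -subr_ge0; have := f0 (y - x); rewrite linB//; apply;
    rewrite -rle_sub.
have fx0 := f0 x x0; have fy0 := le_trans fx0 fxy.
by rewrite !ger0_norm.
Qed.

End BanachLatticeNorm.

(** * The dual of a Banach lattice is a Riesz space *)

Section OperatorNorm.
Variables (R : realType) (V W : normedModType R).

Lemma le_opnorm (T : V -> W) x : bounded_operator T ->
  `|T x| <= opnorm T * `|x|.
Proof.
move=> bT; have lT := bT.1.
have [->|x0] := eqVneq x 0; first by rewrite lin0// !normr0 mulr0.
have nx0 : 0 < `|x| by rewrite normr_gt0.
have t0 : 0 <= `|x|^-1 by rewrite invr_ge0.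
have := @le_opnorm1 _ _ _ T (`|x|^-1 *: x) bT;
  rewrite (linZ _ _ lT) !normrZ ger0_norm//.
by rewrite !ler_pdivrMl// mulr1 lexx mulrC; exact.
Qed.

Lemma opnorm_ge0 (T : V -> W) : bounded_operator T -> 0 <= opnorm T.
Proof.
by move=> bT; apply: le_trans (le_opnorm1 (x := 0) bT _); rewrite ?normr0.
Qed.

End OperatorNorm.

Section DualEvaluation.
Variables (R : realType) (Y : normedModType R).
Implicit Types f g : dual Y.

Lemma dual_linear f : linear f.
Proof. by have [] := dual_bounded f. Qed.

Lemma dualD f g x : (f + g) x = f x + g x. Proof. by []. Qed.
Lemma dualB f g x : (f - g) x = f x - g x. Proof. by []. Qed.
Lemma dualZ a f x : (a *: f) x = a * f x. Proof. by []. Qed.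

Lemma dual_sum (I : Type) (s : seq I) (P : pred I) (F : I -> dual Y) x :
  (\sum_(i <- s | P i) F i) x = \sum_(i <- s | P i) F i x.
Proof. by elim/big_ind2: _ => //= g a h b <- <-. Qed.

Lemma dual_ext f g : (forall x, f x = g x) -> f = g.
Proof. by move=> fg; apply/val_inj/funext. Qed.

Lemma le_dual_norm f x : `|f x| <= `|f| * `|x|.
Proof. exact: le_opnorm (dual_bounded f). Qed.

Lemma exists_dual (T : Y -> R^o) : bounded_operator T ->
  exists f : dual Y, f = T :> (Y -> R^o).
Proof.
move=> bT; have h : T \in @bounded_functional R Y by apply/asboolP.
by exists (Dual h).
Qed.

End DualEvaluation.

Section DualLattice.
Variables (R : realType) (E : banachLatticeType R).
Implicit Types f g h : dual E.

Definition dual_le f g := forall x : E, 0 <=V x -> f x <= g x.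

Let dual_le_refl f : dual_le f f.
Proof. by move=> x _. Qed.

Let dual_le_trans g f h : dual_le f g -> dual_le g h -> dual_le f h.
Proof. by move=> fg gh x x0; exact: le_trans (fg x x0) (gh x x0). Qed.

Let dual_le_anti f g : dual_le f g -> dual_le g f -> f = g.
Proof.
move=> fg gf; have e x : 0 <=V x -> f x = g x.
  by move=> x0; apply/le_anti/andP; split; [exact: fg|exact: gf].
apply: dual_ext => x; rewrite [x]rpos_sub !linB; do ?exact: dual_linear.
by rewrite !e//; exact: rpos_ge0.
Qed.

Let dual_le_addr f g h : dual_le f g -> dual_le (f + h) (g + h).
Proof. by move=> fg x x0; rewrite !dualD lerD2r; exact: fg. Qed.

Let dual_le_scale (a : R) f g : 0 <= a -> dual_le f g ->
  dual_le (a *: f) (a *: g).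
Proof. by move=> a0 fg x x0; rewrite !dualZ ler_wpM2l//; exact: fg. Qed.

(** Bounded functionals are order bounded, so they have a positive part as linear
    maps; being positive, it is bounded. *)
Let dual_pos_exists f : exists g, forall x : E, 0 <=V x ->
  (forall z, 0 <=V z -> z <=V x -> f z <= g x) /\
  (forall u : R, (forall z, 0 <=V z -> z <=V x -> f z <= u) -> g x <= u).
Proof.
have [|P [lP PP]] := riesz_kantorovich (@real_order_complete R) (dual_linear f).
  move=> x x0; exists (`|f| * `|x|) => z z0 zx.
  apply: le_trans (ler_norm _) _; apply: le_trans (le_dual_norm _ _) _.
  by apply: ler_wpM2l => //; exact: norm_mono.
have P0 x : 0 <=V x -> 0 <= P x.
  move=> x0; have := (PP x x0).1 0 (rle_refl _) x0.
  by rewrite lin0//; exact: dual_linear.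
have [g gP] := exists_dual (positive_functional_bounded lP P0).
by exists g => x x0; rewrite gP; exact: PP.
Qed.

Definition dual_pos f : dual E := sval (cid (dual_pos_exists f)).

Let dual_posP f x : 0 <=V x ->
  (forall z, 0 <=V z -> z <=V x -> f z <= dual_pos f x) /\
  (forall u : R, (forall z, 0 <=V z -> z <=V x -> f z <= u) ->
    dual_pos f x <= u).
Proof. by rewrite /dual_pos; case: cid => g /=; exact. Qed.

Definition dual_sup f g := g + dual_pos (f - g).

Let dual_sup_le f g h : dual_le (dual_sup f g) h <-> dual_le f h /\ dual_le g h.
Proof.
split=> [fgh|[fh gh] x x0].
  split=> x x0; apply: le_trans (fgh x x0); rewrite /dual_sup dualD.
    rewrite -lerBlDl -dualB; apply: (dual_posP (f - g) x0).1 => //;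
      exact: rle_refl.
  rewrite lerDl; have := (dual_posP (f - g) x0).1 0 (rle_refl _) x0.
  by rewrite lin0//; exact: dual_linear.
rewrite /dual_sup dualD -lerBrDl; apply: (dual_posP (f - g) x0).2 => z z0 zx.
rewrite dualB; apply: (@le_trans _ _ (h z - g z)).
  by rewrite lerD2r; exact: fh.
have xz : 0 <=V x - z by rewrite -rle_sub.
have := gh _ xz; rewrite !linB; do ?exact: dual_linear.
lra.
Qed.

HB.instance Definition _ := isRiesz.Build R (dual E) dual_le_refl dual_le_anti
  dual_le_trans dual_sup_le dual_le_addr dual_le_scale.

Lemma dual_rposP f x : 0 <=V x ->
  (forall z, 0 <=V z -> z <=V x -> f z <= rpos f x) /\
  (forall u : R, (forall z, 0 <=V z -> z <=V x -> f z <= u) -> rpos f x <= u).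
Proof.
move=> x0; have -> : rpos f = dual_pos f; last exact: dual_posP.
by rewrite /rpos /rsup/= /dual_sup subr0 add0r.
Qed.


Lemma dual_abs_le f (x : E) : 0 <=V f -> `|f x| <= f (rabs x).
Proof.
move=> f0; rewrite -real_rabs; apply: positive_abs_le (dual_linear f) _.
by move=> y y0; exact: f0.
Qed.

Lemma dual_rabsE f (x : E) : rabs f x = rpos f x + rpos (- f) x.
Proof. exact: dualD. Qed.

Lemma dual_norm_le f (c : R) : 0 <=V f -> 0 <= c ->
  (forall x : E, 0 <=V x -> f x <= c * `|x|) -> `|f| <= c.
Proof.
move=> f0 c0 fc; apply: opnorm_le => [|x x1]; first exact: dual_bounded.
apply: le_trans (dual_abs_le _ f0) _; apply: le_trans (fc _ (rabs_ge0 _)) _.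
by rewrite norm_rabs ler_piMr.
Qed.

Lemma dual_norm_mono f g : 0 <=V f -> f <=V g -> `|f| <= `|g|.
Proof.
move=> f0 fg; apply: dual_norm_le => // x x0.
by apply: le_trans (fg x x0) _; apply: le_trans (ler_norm _) (le_dual_norm _ _).
Qed.

Lemma dual_norm_pos f : `|rpos f| <= `|f|.
Proof.
apply: dual_norm_le => [||x x0]; [exact: rpos_ge0|exact: normr_ge0|].
apply: (dual_rposP f x0).2 => z z0 zx.
apply: le_trans (ler_norm _) _; apply: le_trans (le_dual_norm _ _) _.
by apply: ler_wpM2l => //; exact: norm_mono.
Qed.

Lemma dual_norm_abs f : `|rabs f| <= 2 * `|f|.
Proof.
rewrite /rabs (le_trans (ler_normD _ _))// mulr_natl mulr2n lerD//.
  exact: dual_norm_pos.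
by rewrite -(normrN f); exact: dual_norm_pos.
Qed.

(** Riesz--Kantorovich once more, with the dual as the domain.  The positive part
    is bounded because [`|f^+| <= `|f|] for every functional [f]. *)
Lemma bidual_decomposition (phi : dual (dual E)) :
  exists P Q : dual (dual E),
    [/\ forall f, 0 <=V f -> 0 <= P f, forall f, 0 <=V f ->
      0 <= Q f & phi = P - Q].
Proof.
have lphi := dual_linear phi.
have phi_le z x : 0 <=V z -> z <=V x -> phi z <= `|phi| * `|x|.
  move=> z0 zx; apply: le_trans (ler_norm _) _;
    apply: le_trans (le_dual_norm _ _) _.
  by apply: ler_wpM2l => //; exact: dual_norm_mono.
have [|P [lP PP]] := riesz_kantorovich (@real_order_complete R) lphi.
  by move=> x x0; exists (`|phi| * `|x|) => z z0 zx; exact: phi_le.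
have P0 x : 0 <=V x -> 0 <= P x.
  by move=> x0; have := (PP x x0).1 0 (rle_refl _) x0; rewrite (lin0 lphi).
have Pb x : 0 <=V x -> `|P x| <= `|phi| * `|x|.
  move=> x0; rewrite ger0_norm ?P0//; apply: (PP x x0).2 => z z0 zx;
    exact: phi_le.
have bP : bounded_operator P.
  split=> //; exists (2 * `|phi|) => f.
  rewrite [f in P f]rpos_sub (linB _ _ lP) (le_trans (ler_normB _ _))//.
  rewrite -mulrA mulr_natl mulr2n lerD//; apply: le_trans (Pb _ (rpos_ge0 _)) _;
    apply: ler_wpM2l => //; first exact: dual_norm_pos.
  by rewrite -(normrN f); exact: dual_norm_pos.
have [p pP] := exists_dual bP.
exists p, (p - phi); split=> [f f0|f f0|]; last by rewrite opprB addrC subrK.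
  by rewrite pP; exact: P0.
by rewrite dualB subr_ge0 pP; apply: (PP f f0).1 => //; exact: rle_refl.
Qed.

End DualLattice.

(** * Sequences *)

Section Subsequences.

(** Dependent choice along finite prefixes; it builds the subsequences below,
    whose terms have to suit all the earlier ones. *)
Lemma dependent_choice_seq (Q : seq nat -> nat -> Prop) :
  (forall s, exists n, Q s n) -> exists k : nat ->
    nat, forall n, Q (mkseq k n) (k n).
Proof.
move=> /choice[g gQ].
pose fix pre n := if n is n'.+1 then rcons (pre n') (g (pre n')) else [::].
exists (fun n => g (pre n)) => n.
suff e : mkseq (fun n => g (pre n)) n = pre n by rewrite e; exact: gQ.
by elim: n => // n IH; rewrite /mkseq -addn1 iotaD map_cat cats1 addn1/= -IH.
Qed.

Lemma mkseq_lt_increasing (k : nat -> nat) :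
  (forall n i, i \in mkseq k n -> (i < k n)%N) -> forall m n, (m < n)%N ->
    (k m < k n)%N.
Proof.
by move=> kk m n mn; apply: kk; apply: map_f; rewrite mem_iota.
Qed.

Lemma increasing_ge_id (k : nat -> nat) :
  (forall m n, (m < n)%N -> (k m < k n)%N) -> forall n, (n <= k n)%N.
Proof. by move=> kk; elim=> // n IH; exact: leq_ltn_trans IH (kk _ _ _). Qed.

Lemma cvg_subseq (T : topologicalType) (u : nat -> T) (l : T) (k : nat -> nat) :
  (forall m n, (m < n)%N -> (k m < k n)%N) ->
  u @ \oo --> l -> (u \o k) @ \oo --> l.
Proof.
move=> kk ul; apply: cvg_comp ul => A [N _ NA].
by exists N => // n /= Nn; apply: NA;
  apply: leq_trans Nn (increasing_ge_id kk n).
Qed.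

Variable R : realType.

Lemma cvg_ext (u v : nat -> R) (l : R) : (forall n, u n = v n) ->
  v @ \oo --> l -> u @ \oo --> l.
Proof. by move=> uv; rewrite (funext uv). Qed.

Lemma not_cvg0 (u : nat -> R) : ~ (u @ \oo --> (0 : R)) ->
  exists2 e : R, 0 < e & forall N, exists2 n, (N <= n)%N & e <= `|u n|.
Proof.
move=> nu; apply: contrapT => ne; apply: nu; apply/cvgrPdist_lt => e e0.
apply: contrapT => nN; apply: ne; exists e => // N.
apply: contrapT => nn; apply: nN; exists N => // n /= Nn.
rewrite sub0r normrN ltNge; apply/negP => en; apply: nn; by exists n.
Qed.

Lemma sum_increasing_le (u : nat -> R) (k : nat -> nat) p J :
  (forall n, 0 <= u n) -> (forall m n, (m < n)%N -> (k m < k n)%N) ->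
    (p <= J)%N ->
  \sum_(p <= i < J) u (k i) <= \sum_(k p <= n < k J) u n.
Proof.
move=> u0 kk; elim: J => [|J IH]; first by rewrite leqn0 => /eqP->;
  rewrite !big_geq.
rewrite leq_eqVlt => /orP[/eqP<-|]; first by rewrite !big_geq.
rewrite ltnS => pJ; rewrite big_nat_recr//= [leRHS](big_cat_nat (n :=
  k J))//=; last 2 first.
- by move: pJ; rewrite leq_eqVlt => /orP[/eqP->|/kk/ltnW].
- exact/ltnW/kk.
rewrite lerD ?IH// big_ltn ?kk//= lerDl; exact: sumr_ge0.
Qed.

Lemma summable_tail (u : nat -> R) (C e : R) : (forall n, 0 <= u n) ->
  (forall N, \sum_(n < N) u n <= C) -> 0 < e ->
  exists N, forall P Q, (N <= P)%N -> \sum_(P <= n < Q) u n <= e.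
Proof.
move=> u0 uC e0; set S := [set \sum_(n < N) u n | N in [set: nat]].
have hS : has_sup S.
  by split; [exists (\sum_(n < 0) u n), 0%N|exists C => _ [N _ <-]].
have [_ [N _ <-] NS] := sup_adherent e0 hS; exists N => P Q NP.
have [QP|PQ] := leqP Q P; first by rewrite big_geq// ltW.
have SQ : \sum_(n < Q) u n <= sup S by apply: ub_le_sup; [case: hS|exists Q].
have : \sum_(n < N) u n <= \sum_(n < P) u n.
  by rewrite -!(big_mkord xpredT u) [leRHS](big_cat_nat (n := N))//= lerDl;
    exact: sumr_ge0.
move: SQ; rewrite -!(big_mkord xpredT u) (big_cat_nat (n := P))//=;
  last exact: ltnW.
by rewrite -(big_mkord xpredT u) in NS; lra.
Qed.

End Subsequences.

(** * Schur property of l1 *)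

Section GlidingHump.
Variables (R : realType) (V : normedModType R).

Lemma sum_functional (phi : nat -> V -> R^o) (M : R) :
  (forall n, linear (phi n)) ->
  (forall N h, \sum_(n < N) `|phi n h| <= M * `|h|) ->
  exists psi : dual V, forall h, \sum_(n < N) phi n h @[N --> \oo] --> psi h.
Proof.
move=> lphi phiM.
have sM N h : `|\sum_(n < N) phi n h| <= M * `|h|.
  by apply: le_trans (phiM N h); exact: ler_norm_sum.
have cv h : cvgn (fun N => \sum_(n < N) phi n h : R).
  have -> : (fun N => \sum_(n < N) phi n h : R) = series (fun n => phi n h : R).
    by apply/funext => N; rewrite /series/= big_mkord.
  apply: (@normed_cvg R R^o); apply: nondecreasing_is_cvgn.
    by apply: nondecreasing_series => n _ _; exact: normr_ge0.
  exists (M * `|h|) => y [N _ <-].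
  by have := phiM N h; rewrite -(big_mkord xpredT (fun n => `|phi n h|)).
have [psi psiP] : exists psi : V -> R^o,
    forall h, (\sum_(n < N) phi n h : R) @[N --> \oo] --> (psi h : R).
  by exists (fun h => limn (fun N => \sum_(n < N) phi n h : R)) => h; exact: cv.
have [f fpsi] : exists f : dual V, f = psi :> (V -> R^o).
  apply: exists_dual; split.
    move=> a x y.
    have e N : \sum_(n < N) phi n (a *: x + y) =
        a * (\sum_(n < N) phi n x : R) + (\sum_(n < N) phi n y : R) :> R.
      by rewrite mulr_sumr -big_split; apply: eq_bigr => n _; rewrite lphi.
    have c1 : (a * (\sum_(n < N) phi n x : R) + (\sum_(n < N) phi n y : R) : R) @[N --> \oo]
        --> (a * psi x + psi y : R).
      by apply: cvgD; [apply: cvgM; [exact: cvg_cst|exact: psiP]|exact: psiP].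
    have c2 := psiP (a *: x + y); exact: (norm_cvg_unique c2 (cvg_ext e c1)).
  exists M => h.
  have c : `|\sum_(n < N) phi n h : R| @[N --> \oo] --> `|psi h : R|.
    by apply: cvg_norm; exact: psiP.
  by apply: (cvgr_to_le c); exact: nearW.
by exists f => h; rewrite fpsi; exact: psiP.
Qed.

(** Consider the numbers [phi n (h m - g)].  If the diagonal did not vanish, one
    could extract a subsequence [k] along which the diagonal entries stay above
    [e] while the rest of each row [\sum_(i <> j) `|phi (k i) (h (k j) - g)|] is
    at most [e / 2]: terms with [i < j] are small by weak convergence, terms with
    [i > j] by summability.  The functional [\sum_i phi (k i)] would then stay
    above [e / 2] along [h (k j) - g], against weak convergence. *)
Theorem gliding_hump (phi : nat -> V -> R^o) (M : R) (h : nat -> V) :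
  (forall n, linear (phi n)) ->
  (forall N x, \sum_(n < N) `|phi n x| <= M * `|x|) ->
  (exists g, weakly_cvg h g) ->
  (phi n (h n) : R) @[n --> \oo] --> (0 : R).
Proof.
move=> lphi phiM [g hg].
have phi1 n x : `|phi n x| <= M * `|x|.
  apply: le_trans (phiM n.+1 x); rewrite big_ord_recr/= lerDr.
  by apply: sumr_ge0 => i _; exact: normr_ge0.
pose a n m : R := phi n (h m - g).
have aw (f : dual V) : (f (h m - g) : R) @[m --> \oo] --> (0 : R).
  have c : (f (h m) - f g : R) @[m --> \oo] --> (f g - f g : R).
    by apply: cvgB; [exact: hg|exact: cvg_cst].
  rewrite subrr in c; apply: (cvg_ext _ c) => m.
  by rewrite linB//; exact: dual_linear.
have a0 n : a n m @[m --> \oo] --> (0 : R).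
  have [f fE] : exists f : dual V, f = phi n :> (V -> R^o).
    by apply: exists_dual; split => //; exists M.
  by apply: (cvg_ext _ (aw f)) => m; rewrite fE.
have u0 m n : 0 <= `|a n m| by exact: normr_ge0.
(* Rows are summable: the sum over the functionals from some index on is small,
   for each fixed vector. *)
have tail m (e : R) : 0 < e ->
    exists N, forall P Q, (N <= P)%N -> \sum_(P <= n < Q) `|a n m| <= e.
  by apply: (summable_tail (u0 m)) => N; exact: phiM.
have phig : (phi n g : R) @[n --> \oo] --> (0 : R).
  apply/cvgrPdist_le => e e0.
  have [N NP] := @summable_tail _ (fun n => `|phi n g : R|) (M * `|g|) e
    (fun n => normr_ge0 _) (fun N => phiM N g) e0.
  exists N => // n /= Nn; rewrite sub0r normrN.
  by have := NP n n.+1 Nn; rewrite big_nat1.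
suff ann : a n n @[n --> \oo] --> (0 : R).
  have c : (a n n + phi n g : R) @[n --> \oo] --> (0 + 0 : R) by apply: cvgD.
  rewrite addr0 in c; apply: (cvg_ext _ c) => n.
  by rewrite /a linB// subrK.
apply: contrapT => /not_cvg0[e e0 ane].
have e4 : 0 < e / 4 by rewrite divr_gt0.
pose Q s n := [/\ forall i, i \in s -> (i < n)%N, e <= `|a n n|,
  \sum_(i <- s) `|a i n| <= e / 4 &
  forall i, i \in s -> forall P, \sum_(n <= j < P) `|a j i| <= e / 4].
have [k kQ] : exists k : nat -> nat, forall n, Q (mkseq k n) (k n).
  apply: dependent_choice_seq => s.
  have [N1 N1P] : exists N, forall n, (N <= n)%N ->
    \sum_(i <- s) `|a i n| <= e / 4.
    have c : \sum_(i <- s) `|a i n| @[n --> \oo] --> (0 : R).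
      elim: (s) => [|i r IH].
        by apply: (cvg_ext _ (cvg_cst _)) => n; rewrite big_nil.
      have c : (`|a i n| + \sum_(i <- r) `|a i n|) @[n --> \oo] --> (`|0 : R| + 0 : R).
        by apply: cvgD => //; apply: cvg_norm; exact: a0.
      by rewrite normr0 addr0 in c; apply: (cvg_ext _ c) => n; rewrite big_cons.
    move/cvgrPdist_le : c => /(_ _ e4)[N _ NP]; exists N => n Nn.
    by have := NP n Nn; rewrite sub0r normrN; apply: le_trans; exact: ler_norm.
  have [N2 N2P] : exists N, forall i, i \in s -> forall n P, (N <= n)%N ->
      \sum_(n <= j < P) `|a j i| <= e / 4.
    elim: (s) => [|i r [N NP]]; first by exists 0%N.
    have [N' N'P] := tail i _ e4; exists (maxn N N') => j.
    rewrite inE => /orP[/eqP->|jr] n P; rewrite geq_max => /andP[Nn N'n].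
      exact: N'P.
    exact: NP.
  have [n] := ane (maxn (maxn N1 N2) (\max_(i <- s) i.+1)).
  rewrite !geq_max => /andP[/andP[N1n N2n] sn] en; exists n; split => //.
  - by move=> i si; apply: leq_trans sn; exact: (leq_bigmax_seq (F := S) i si).
  - exact: N1P.
  - by move=> i si P; exact: N2P.
have kk : forall m n, (m < n)%N -> (k m < k n)%N.
  by apply: mkseq_lt_increasing => n; case: (kQ n).
have [psi psiP] : exists psi : dual V, forall x,
    (\sum_(n < N) phi (k n) x : R) @[N --> \oo] --> (psi x : R).
  apply: (sum_functional (phi := fun n => phi (k n)) (M := M)) => // N x.
  apply: le_trans (phiM (k N) x).
  rewrite -(big_mkord xpredT (fun n => `|phi (k n) x|)).
  rewrite -(big_mkord xpredT (fun n => `|phi n x|)).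
  apply: le_trans (sum_increasing_le (u := fun n =>
    `|phi n x : R|) _ kk (leq0n N)) _.
    by move=> n; exact: normr_ge0.
  by rewrite [leRHS](big_cat_nat (n := k 0%N))//= ?lerDr ?sumr_ge0//;
    case: (N) => // N'; apply/ltnW/kk.
have psik : (psi (h (k j) - g) : R) @[j --> \oo] --> (0 : R).
  exact: (cvg_subseq kk (aw psi)).
have psige j : e / 2 <= `|psi (h (k j) - g) : R|.
  have c : `|\sum_(n < N) phi (k n) (h (k j) - g) : R| @[N --> \oo]
      --> `|psi (h (k j) - g) : R| by apply: cvg_norm; exact: psiP.
  apply: (cvgr_to_ge c); exists j.+1 => // N /= jN.
  rewrite -(big_mkord xpredT (fun n => phi (k n) (h (k j) - g))).
  rewrite (big_cat_nat (n := j))//=; last exact: ltnW.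
  rewrite (big_ltn jN)/=.
  have [_ ejj sj _] := kQ j; have [_ _ _ tj] := kQ j.+1.
  have h1 : `|\sum_(0 <= i < j) phi (k i) (h (k j) - g)| <= e / 4.
    apply: le_trans (ler_norm_sum _ _ _) _; apply: le_trans sj.
    by rewrite /mkseq big_map /index_iota subn0.
  have h2 : `|\sum_(j.+1 <= i < N) phi (k i) (h (k j) - g)| <= e / 4.
    apply: le_trans (ler_norm_sum _ _ _) _.
    apply: le_trans (sum_increasing_le (u := fun n =>
      `|a n (k j)|) (u0 _) kk jN) _.
    by apply: tj; apply: map_f; rewrite mem_iota/=.
  move: h1 h2 ejj; rewrite /a.
  set A := \sum_(0 <= i < j) _; set B := phi (k j) _;
    set C := \sum_(_ <= i < N) _.
  move=> h1 h2 ejj.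
  have : `|B| <= `|A + (B + C)| + `|A| + `|C|.
    have {1}-> : B = (A + (B + C)) - A - C by rewrite [A + _]addrC !addrK.
    by rewrite (le_trans (ler_normB _ _))// lerD2r ler_normB.
  lra.
have e2 : 0 < e / 4 by [].
move/cvgrPdist_le : psik => /(_ _ e4)[N _ /(_ N (leqnn N))].
by rewrite sub0r normrN; have := psige N; lra.
Qed.

End GlidingHump.

(** * Disjoint sequences in the dual *)

Section BandPart.
Variables (R : realType) (V : rieszType R).

(** The restriction of [phi] to the band generated by [g]: on the cone,
    [p x] is the supremum of [phi (rinf x (k *: g))] over [k > 0]. *)
Lemma band_part (phi : V -> R^o) (g : V) : linear phi ->
  (forall x, 0 <=V x -> 0 <= phi x) -> 0 <=V g ->
  exists p : V -> R^o, linear p /\ forall x, 0 <=V x ->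
    (forall k : R, 0 < k -> phi (rinf x (k *: g)) <= p x) /\
    (forall u : R, (forall k : R, 0 < k -> phi (rinf x (k *: g)) <= u) ->
      p x <= u).
Proof.
move=> lphi phi0 g0.
have mono x y : x <=V y -> phi x <= phi y by exact: (positive_mono lphi phi0).
have kg0 (k : R) : 0 < k -> 0 <=V k *: g by move=> k0;
  apply: rscale_ge0 => //; exact: ltW.
pose S x : set R := [set phi (rinf x (k *: g)) | k in [set k : R | 0 < k]].
have hS x : has_sup (S x).
  split; first by exists (phi (rinf x (1 *: g))), 1 => //=; exact: ltr01.
  by exists (phi x) => _ [k _ <-]; apply: mono; exact: rinf_lel.
pose q x : R^o := sup (S x).
have q1 x (k : R) : 0 < k -> phi (rinf x (k *: g)) <= q x.
  by move=> k0; apply: ub_le_sup; [case: (hS x)|exists k].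
have q2 x (u : R) : (forall k : R, 0 < k -> phi (rinf x (k *: g)) <= u) ->
  q x <= u.
  by move=> h; apply: ge_sup; [case: (hS x)|move=> _ [k k0 <-]; exact: h].
have qD : cone_additive q.
  move=> x y x0 y0; apply/le_anti/andP; split.
    apply: q2 => k k0.
    apply: le_trans (mono _ _ (rinfD_le x0 y0 (kg0 k k0))) _.
    by rewrite linD//; apply: lerD; exact: q1.
  rewrite -lerBrDr; apply: (q2) => k k0; rewrite lerBrDr addrC -lerBrDr.
  apply: q2 => l l0; rewrite lerBrDr -linD//.
  have m0 : 0 < Num.max k l by rewrite lt_max k0.
  apply: (@le_trans _ _ (phi (rinf (x + y) ((2 * Num.max k l) *: g))));
    last first.
    by apply: q1; rewrite mulr_gt0.
  rewrite -scalerA; apply: mono; rewrite addrC;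
    apply: rle_trans (rinfD_ge _ _ _).
  by apply: rle_add; apply: rinf_mono (rle_refl _) _; apply: rle_scalel => //;
    rewrite le_max lexx ?orbT.
have qZ : cone_homogeneous q.
  have le (a : R) x : 0 < a -> a * q x <= q (a *: x).
    move=> a0; rewrite -ler_pdivlMl//; apply: q2 => k k0; rewrite ler_pdivlMl//.
    apply: le_trans (q1 (a *: x) (a * k) (mulr_gt0 a0 k0)).
    by rewrite -scalerA rinfZ// (linZ _ _ lphi).
  move=> a x a0 _; apply/le_anti/andP; split; last exact: le.
  have ai0 : 0 < a^-1 by rewrite invr_gt0.
  have := le a^-1 (a *: x) ai0; rewrite scalerA mulVf ?gt_eqF// scale1r.
  by rewrite ler_pdivrMl.
exists (cone_ext q); split; first exact: cone_ext_linear.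
by move=> x x0; rewrite cone_ext_pos//; split=> [k|u]; [exact: q1|exact: q2].
Qed.

(** For disjoint [g n], the vectors [rinf x (k *: g n)] add up to at most [x].  The
    suprema over [k] are taken one index at a time, which is legitimate because
    [phi (rinf x (k *: g))] increases with [k]. *)
Lemma band_parts_sum_le (phi : V -> R^o) (g : nat -> V) (p : nat -> V ->
  R^o) N x :
  linear phi -> (forall x, 0 <=V x -> 0 <= phi x) ->
  (forall n, 0 <=V g n) ->
  (forall n m, (n < m)%N -> rinf (g n) (g m) = 0) ->
  (forall n x, 0 <=V x -> forall u : R,
     (forall k : R, 0 < k -> phi (rinf x (k *: g n)) <= u) -> p n x <= u) ->
  0 <=V x -> \sum_(n < N) p n x <= phi x.
Proof.
move=> lphi phi0 g0 gg pP x0.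
have mono y z : y <=V z -> phi y <= phi z by exact: (positive_mono lphi phi0).
rewrite -(big_mkord xpredT (fun n => p n x)).
(* The first [M] terms are already suprema, the others still use a common [k]. *)
suff h M : (M <= N)%N -> forall k : R, 0 < k ->
    \sum_(0 <= n < M) p n x + \sum_(M <= n < N) phi (rinf x (k *: g n)) <= phi x.
  by have := h N (leqnn N) 1 ltr01; rewrite [X in _ + X]big_geq// addr0.
elim: M => [|M IH] MN k k0.
  rewrite big_geq// add0r.
  rewrite (_ : \sum_(0 <= n < N) _ = phi (\sum_(n < N) rinf x (k *: g n))).
    exact/mono/rinf_sum_disjoint_le.
  rewrite big_mkord; elim/big_ind2: _ => [|a b c d -> ->|//];
    first by rewrite lin0.
  by rewrite linD.
rewrite big_nat_recr//= addrAC -lerBrDl.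
apply: pP => // l l0; rewrite lerBrDl.
have m0 : 0 < Num.max k l by rewrite lt_max k0.
apply: le_trans (IH (ltnW MN) _ m0); rewrite -addrA lerD2l.
rewrite [leRHS]big_ltn// addrC; apply: lerD.
  apply: mono; apply: rinf_mono (rle_refl _) _; apply: rle_scalel => //.
  by rewrite le_max lexx orbT.
apply: ler_sum => n _; apply: mono; apply: rinf_mono (rle_refl _) _.
by apply: rle_scalel => //; rewrite le_max lexx.
Qed.

End BandPart.

Section DisjointDual.
Variables (R : realType) (E : banachLatticeType R).

(** The band parts [p n] of a positive [phi] with respect to [g n] satisfy
    [phi (g n) <= p n ((f n)^+) = p n (f n)], since [(f n)^-] is disjoint from
    [g n]; and [p n (f n) --> 0] by the gliding hump. *)
Theorem disjoint_weakly_null (f g : nat -> dual E) :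
  (exists l, weakly_cvg f l) ->
  (forall n, 0 <=V g n) -> (forall n, g n <=V rpos (f n)) ->
  (forall n m, (n < m)%N -> rinf (g n) (g m) = 0) ->
  weakly_cvg g 0.
Proof.
move=> cf g0 gf gg.
suff pos (phi : dual (dual E)) : (forall h, 0 <=V h -> 0 <= phi h) ->
    (phi (g n) : R) @[n --> \oo] --> (0 : R).
  move=> phi; have [P [Q [P0 Q0 ->]]] := bidual_decomposition phi.
  rewrite lin0; last exact: dual_linear.
  have c : (P (g n) - Q (g n) : R) @[n --> \oo] --> (0 - 0 : R).
    by apply: cvgB; exact: pos.
  by rewrite subrr in c.
move=> phi0; have lphi := dual_linear phi.
have /choice[p pP] n := band_part lphi phi0 (g0 n).
have lp n : linear (p n) by case: (pP n).
have p1 n := (pP n).2.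
have p0 n x : 0 <=V x -> 0 <= p n x.
  move=> x0; apply: le_trans ((p1 n x x0).1 1 ltr01).
  by apply: phi0; apply: rinf_ge0 => //; rewrite scale1r.
have c : (p n (f n) : R) @[n --> \oo] --> (0 : R).
  apply: (gliding_hump (M := `|phi| * 2)) => // N x.
  apply: (@le_trans _ _ (\sum_(n < N) p n (rabs x))).
    by apply: ler_sum => n _; rewrite -real_rabs;
      exact: (positive_abs_le _ (lp n) (p0 n)).
  apply: (@le_trans _ _ (phi (rabs x))).
    apply: (band_parts_sum_le (g := g)) => //; last exact: rabs_ge0.
    by move=> n y y0; exact: (p1 n y y0).2.
  apply: le_trans (ler_norm _) _; apply: le_trans (le_dual_norm _ _) _.
  by rewrite -mulrA ler_wpM2l//; exact: dual_norm_abs.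
have pneg n : p n (rpos (- f n)) <= 0.
  apply: (p1 n _ (rpos_ge0 _)).2 => k k0.
  rewrite (_ : rinf _ _ = 0) ?lin0//.
  have k1 : 0 < k + 1 by rewrite addr_gt0.
  apply: (rinf0_mono (x := (k + 1) *: rpos (- f n)) (y :=
    (k + 1) *: rpos (f n))).
  - exact: rpos_ge0.
  - by apply: rscale_ge0 => //; exact: ltW.
  - rewrite -[X in X <=V _]scale1r; apply: rle_scalel; last exact: rpos_ge0.
    by rewrite lerDr ltW.
  - apply: (@rle_trans _ _ (k *: rpos (f n)));
    first by apply: rle_scale => //; exact: ltW.
    by apply: rle_scalel; [rewrite lerDl|exact: rpos_ge0].
  - by rewrite rinfZ// rinfC rinf_pos_neg scaler0.
apply: (squeeze_cvgr _ (cvg_cst 0) c); apply: nearW => n; rewrite phi0//=.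
rewrite [f n in leRHS]rpos_sub (linB _ _ (lp n)).
apply: (@le_trans _ _ (p n (rpos (f n)))); last by rewrite lerDl oppr_ge0.
apply: le_trans ((p1 n _ (rpos_ge0 _)).1 1 ltr01).
apply: (positive_mono lphi phi0); apply/rinf_ge; split => //.
by rewrite scale1r; exact: rle_refl.
Qed.

End DisjointDual.

(** * Domination for almost MW-operators *)

Lemma bounded_fun_norm_le (R : realType) (V : normedModType R) (x : nat -> V) :
  bounded_fun x -> exists2 C : R, 0 <= C & forall n, `|x n| <= C.
Proof.
move=> [M [_ xM]]; exists (`|M| + 1); first by rewrite addr_ge0.
move=> n; apply: xM => //; rewrite (le_lt_trans (ler_norm M))// ltrDl//.
Qed.

(** Evaluations at points are elements of the bidual, so the sequence is
    pointwise bounded and the uniform boundedness principle applies. *)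
Lemma weakly_cvg_bounded (R : realType) (Y : completeNormedModType R) (f : nat -> dual Y) :
  (exists g, weakly_cvg f g) -> exists2 C : R, 0 <= C & forall n, `|f n| <= C.
Proof.
move=> [g fg]; pose F := [set (f n : Y -> R^o) | n in [set: nat]].
have [||M FM] := @Banach_Steinhauss R Y R^o F _ _ 1.
- move=> _ [n _ <-]; split; last exact: dual_linear.
  move=> r; exists (`|f n| * r) => x xr; apply: le_trans (le_dual_norm _ _) _.
  exact: ler_wpM2l.
- move=> x; have [ev evE] : exists ev : dual (dual Y), ev = (fun h =>
  h x) :> (dual Y -> R^o).
    apply: exists_dual; split => //; exists `|x| => h; rewrite mulrC;
      exact: le_dual_norm.
  have := fg ev; rewrite evE => fx.
  have [C _ fC] : exists2 C : R, 0 <= C & forall n, `|f n x : R^o| <= C.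
    apply: bounded_fun_norm_le; apply: cvg_seq_bounded; apply/cvg_ex.
    by exists (g x).
  by exists C => _ [n _ <-].
exists `|M| => // n; apply: opnorm_le; first exact: dual_bounded.
by move=> x x1; apply: le_trans (FM _ _ _ x1) (ler_norm _); exists n.
Qed.

Section AlmostMWLattice.
Variables (R : realType) (E : banachLatticeType R).

(** The definition applied to a constant sequence of functionals. *)
Lemma aMW_weakly_null (T : E -> E) (x : nat -> E) (f : dual E) : aMW E E T ->
  disjoint_seq x -> bounded_fun x -> (f (T (x n)) : R) @[n --> \oo] --> (0 : R).
Proof.
move=> [_ aT] dx bx; apply: (aT x (fun _ => f)) => //.
by exists f => phi; exact: cvg_cst.
Qed.

Lemma bounded_by_fun (V : normedModType R) (x : nat -> V) (C : R) :
  (forall n, `|x n| <= C) -> bounded_fun x.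
Proof.
move=> xC; exists C; split; first exact: num_real.
by move=> M CM n _; apply: le_trans (xC n) (ltW CM).
Qed.

Lemma exprV2_small (c e : R) : 0 < e ->
  exists N, forall n, (N <= n)%N -> 2^-1 ^+ n * c <= e.
Proof.
move=> e0; have h : (fun n => c * (2^-1 : R) ^+ n) @ \oo --> (0 : R).
  have : `|2^-1 : R| < 1 by rewrite ger0_norm// invf_lt1// ltr1n.
  exact: cvg_geometric.
move/cvgrPdist_le : h => /(_ e e0)[N _ Nh]; exists N => n /Nh.
by rewrite sub0r normrN mulrC; apply: le_trans; exact: ler_norm.
Qed.

(** The key step: the functionals may be replaced by their positive parts, even
    though these need not converge weakly. *)
Theorem aMW_positive_part_null (T : E -> E) (x : nat -> E) (f : nat -> dual E) :
  positive_operator T -> aMW E E T ->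
  (forall n, 0 <=V x n) -> disjoint_seq x -> bounded_fun x ->
  (exists g, weakly_cvg f g) ->
  (rpos (f n) (T (x n)) : R) @[n --> \oo] --> (0 : R).
Proof.
move=> [lT T0] aT x0 dx bx cf.
apply: contrapT => /not_cvg0[e e0 ane].
pose h n := rpos (f n); pose y n := T (x n).
have y0 n : 0 <=V y n by exact/T0/x0.
have h0 n : 0 <=V h n by exact: rpos_ge0.
have hy n m : 0 <= h n (y m) by exact: h0.
have [C C0 fC] := weakly_cvg_bounded cf.
have hC n : `|h n| <= C by apply: le_trans (dual_norm_pos _) (fC n).
have [X X0 xX] := bounded_fun_norm_le bx.
have yX n : `|y n| <= opnorm T * X.
  apply: le_trans (le_opnorm _ aT.1) _; apply: ler_wpM2l (xX n).
  exact: opnorm_ge0 aT.1.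
have e4 : 0 < e / 4 by rewrite divr_gt0.
have [k kP] : exists k : nat -> nat, forall n,
   [/\ forall i, i \in mkseq k n -> (i < k n)%N, e <= h (k n) (y (k n)) &
    4 ^+ size (mkseq k n) * \sum_(i <- mkseq k n) h i (y (k n)) <= e / 4].
  (* The weight depends on the position [size s] in the subsequence, not on the
     index [n] still to be chosen, so that the last condition holds eventually. *)
  pose Q s n := [/\ forall i, i \in s -> (i < n)%N, e <= h n (y n) &
     4 ^+ size s * \sum_(i <- s) h i (y n) <= e / 4].
  apply: (dependent_choice_seq (Q := Q)) => s.
  have c : (4 ^+ size s * \sum_(i <- s) h i (y n) : R) @[n --> \oo] --> (0 : R).
    pose F := \sum_(i <- s) h i.
    have c : (4 ^+ size s * F (y n) : R) @[n --> \oo] --> (4 ^+ size s * 0 : R).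
      by apply: cvgM; [exact: cvg_cst|exact: aMW_weakly_null].
    by rewrite mulr0 in c; apply: (cvg_ext _ c) => n; rewrite dual_sum.
  move/cvgrPdist_le : c => /(_ _ e4)[N _ NP].
  have [n] := ane (maxn N (\max_(i <- s) i.+1)).
  rewrite geq_max => /andP[Nn sn] en; exists n; split.
  - by move=> i si; apply: leq_trans sn; exact: (leq_bigmax_seq (F := S) i si).
  - by move: en; rewrite ger0_norm//; exact: hy.
  - by have := NP n Nn; rewrite sub0r normrN; apply: le_trans; exact: ler_norm.
have kk : forall m n, (m < n)%N -> (k m < k n)%N.
  by apply: mkseq_lt_increasing => n; case: (kP n).
pose w n : R := 2^-1 ^+ n.
have w0 n : 0 < w n by rewrite exprn_gt0.
have [F FP] : exists F : dual E, forall v,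
    (\sum_(n < N) w n * h (k n) v : R) @[N --> \oo] --> (F v : R).
  have [||F FP] := @sum_functional R E (fun n => (w n *: h (k n)) : E ->
    R^o) (C * 2).
  - by move=> n; apply: linear_scale; exact: dual_linear.
  - move=> N v; apply: (@le_trans _ _ (\sum_(n < N) w n * (C * `|v|))).
      apply: ler_sum => n _.
      have -> : `|(w n *: (h (k n) : E -> R^o)) v| = w n * `|h (k n) v : R|.
        by rewrite -[w n in RHS]gtr0_norm// -normrM.
      rewrite ler_wpM2l ?(ltW (w0 n))//.
      apply: le_trans (le_dual_norm _ _) _; exact: ler_wpM2r.
    rewrite -mulr_suml mulrAC [leLHS]mulrC ler_wpM2l ?mulr_ge0//.
    suff -> : \sum_(n < N) w n = 2 - 2 * w N by rewrite lerBlDr lerDl mulr_ge0// ltW.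
    elim: N => [|N IH]; first by rewrite big_ord0 /w expr0; lra.
    by rewrite big_ord_recr/= IH /w exprS; lra.
  by exists F => v; exact: FP.
have wF n : w n *: h (k n) <=V F.
  move=> v v0; apply: (cvgr_to_ge (FP v)); exists n.+1 => // N /= nN.
  rewrite (bigD1 (Ordinal nN))//= lerDl; apply: sumr_ge0 => i _.
  by rewrite mulr_ge0//; [exact: ltW|exact: h0].
have F0 : 0 <=V F by apply: rle_trans (wF 0%N); apply: rscale_ge0 => //;
  exact: ltW.
(* The weights of [S] and [F] are matched so that, for [n < m], the coefficient
   [w n * w m] of [h (k m)] below [g n] and the coefficient [4 ^+ m] of [h (k n)]
   below [g m] have a product at least 1. *)
pose S n := \sum_(i < n) h (k i).
have S0 n : 0 <=V S n by apply: rsum_ge0 => i _.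
pose g n := rpos (h (k n) - (4 ^+ n *: S n + w n *: F)).
have sub0 n : 0 <=V 4 ^+ n *: S n + w n *: F.
  apply: radd_ge0; apply: rscale_ge0;
    [exact: exprn_ge0|exact: S0|exact: ltW|exact: F0].
have g0 n : 0 <=V g n by exact: rpos_ge0.
have gh n : g n <=V h (k n).
  apply: rpos_le => //; apply/rle_subr.
  by rewrite opprK -[X in X <=V _]addr0; apply: rle_add => //; exact: rle_refl.
have gg n m : (n < m)%N -> rinf (g n) (g m) = 0.
  move=> nm.
  apply: rinf0_mono (@rinf_pos_sub0 _ _ (h (k n)) (h (k m)) (w n * w m) (4 ^+ m) _ _ _) => //.
  - apply: rpos_mono; apply: rle_add (rle_refl _) _; apply/(rle_opp _ _).1.
    rewrite -scalerA -[X in X <=V _]add0r; apply: rle_add.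
      by apply: rscale_ge0 => //; exact: exprn_ge0.
    by apply: rle_scale; [exact: ltW|exact: wF].
  - apply: rpos_mono; apply: rle_add (rle_refl _) _; apply/(rle_opp _ _).1.
    rewrite -[X in X <=V _]addr0; apply: rle_add; last first.
      by apply: rscale_ge0 => //; exact: ltW.
    apply: rle_scale; first exact: exprn_ge0.
    rewrite /S (bigD1 (Ordinal nm))//= -[X in X <=V _]addr0.
    by apply: rle_add (rle_refl _) _; apply: rsum_ge0 => i _.
  - by rewrite mulr_gt0.
  - rewrite /w (_ : 4 = 2 * 2); last by lra.
    rewrite exprMn !exprVn -mulrA mulKf; last by rewrite expf_neq0.
    by rewrite ler_pdivlMl ?exprn_gt0// mulr1 ler_weXn2l ?ler1n// ltnW.
have gnull : weakly_cvg g 0.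
  apply: (disjoint_weakly_null (f := f \o k)) => //.
  have [l fl] := cf; exists l => phi; exact: (cvg_subseq kk (fl phi)).
have gT : (g n (y (k n)) : R) @[n --> \oo] --> (0 : R).
  apply: (aT.2 (x \o k) g); last by exists 0.
    move=> n m nm; apply: dx => knm; apply: nm; case: (ltngtP n m) => // /kk;
    by rewrite knm ltnn.
  by apply: (bounded_by_fun (C := X)) => n; exact: xX.
have [N NP] := exprV2_small (`|F| * (opnorm T * X)) e4.
have e8 : 0 < e / 8 by rewrite divr_gt0.
move/cvgrPdist_le : gT => /(_ _ e8)[N' _ N'P].
pose n := maxn N N'; have := N'P n (leq_maxr _ _).
rewrite sub0r normrN; apply/negP; rewrite -ltNge.
have [_ en sn] := kP n.
have : h (k n) (y (k n)) - (4 ^+ n * S n (y (k n)) + w n * F (y (k n))) <= g n (y (k n)).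
  exact: (rle_pos (h (k n) - (4 ^+ n *: S n + w n *: F))).
have : w n * F (y (k n)) <= e / 4.
  apply: le_trans (NP n (leq_maxl _ _)); rewrite ler_wpM2l ?(ltW (w0 n))//.
  apply: le_trans (ler_norm _) _; apply: le_trans (le_dual_norm _ _) _.
  exact: ler_wpM2l.
have : 4 ^+ n * S n (y (k n)) <= e / 4.
  move: sn; rewrite size_mkseq /S dual_sum /mkseq big_map.
  by rewrite -(big_mkord xpredT (fun i => h (k i) (y (k n)))) /index_iota subn0.
move=> a1 a2 a3; apply: lt_le_trans (ler_norm _); lra.
Qed.

End AlmostMWLattice.

(** * Positive and regular operators *)

Section PositiveOperators.
Variables (R : realType) (E : banachLatticeType R).
Implicit Types (S T U M : E -> E).

Lemma positive_operator0 : positive_operator (0 : E -> E).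
Proof.
split=> [a x y|x _]; last exact: rle_refl.
by rewrite !(_ : forall z, (0 : E -> E) z = 0)// scaler0 addr0.
Qed.

Lemma positive_operatorD S T :
  positive_operator S -> positive_operator T -> positive_operator (S + T).
Proof.
move=> [lS S0] [lT T0]; split; first exact: linear_add.
by move=> x x0; apply: radd_ge0; [exact: S0|exact: T0].
Qed.

Lemma positive_operatorZ (a : R) T : 0 <= a ->
  positive_operator T -> positive_operator (a *: T).
Proof.
move=> a0 [lT T0]; split; first exact: linear_scale.
by move=> x x0; apply: rscale_ge0 => //; exact: T0.
Qed.

Lemma positive_operator_comp S T :
  positive_operator S -> positive_operator T -> positive_operator (S \o T).
Proof.
move=> [lS S0] [lT T0]; split; first exact: linear_comp.
by move=> x x0; apply: S0; exact: T0.
Qed.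

Lemma positive_operator_bounded T : positive_operator T -> bounded_operator T.
Proof.
move=> [lT T0]; apply: monotone_bounded => // x y x0 xy.
by apply: norm_mono; [exact: T0|exact: positive_mono].
Qed.

Lemma positive_operator_double T : positive_operator (T + T) ->
  positive_operator T.
Proof.
move=> [lT T0]; have -> : T = 2^-1 *: (T + T).
  by rewrite scalerDr -scalerDl (_ : 2^-1 + 2^-1 = 1 :> R) ?scale1r//; lra.
by apply: positive_operatorZ; rewrite ?invr_ge0.
Qed.

Lemma op_le_app S T x : op_le S T -> 0 <=V x -> S x <=V T x.
Proof. by move=> [_ ST] x0; apply: (rle_sub (S x) (T x)).2; exact: ST. Qed.

Lemma op_le_trans S T U : op_le S T -> op_le T U -> op_le S U.
Proof.
move=> ST TU; have := positive_operatorD TU ST.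
by rewrite addrA subrK.
Qed.

Lemma regularB S T : regular_operators E S -> regular_operators E T ->
  regular_operators E (S - T).
Proof.
move=> [S1 [S2 [pS1 pS2 ->]]] [T1 [T2 [pT1 pT2 ->]]].
exists (S1 + T2), (S2 + T1); split; do ?exact: positive_operatorD.
by rewrite opprB opprD addrACA.
Qed.

Lemma positive_regular T : positive_operator T -> regular_operators E T.
Proof. by move=> pT; exists T, 0; rewrite subr0; split => //;
  exact: positive_operator0. Qed.

Lemma sub_le_add T1 T2 : positive_operator T1 -> positive_operator T2 ->
  op_le (T1 - T2) (T1 + T2) /\ op_le (- (T1 - T2)) (T1 + T2).
Proof.
move=> p1 p2; split.
  rewrite /op_le opprB [T2 - T1]addrC addrACA subrr add0r.
  exact: positive_operatorD.
by rewrite /op_le opprK addrACA subrr addr0; exact: positive_operatorD.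
Qed.

Lemma regular_majorant T : regular_operators E T ->
  exists U, [/\ positive_operator U, op_le T U & op_le (- T) U].
Proof.
move=> [T1 [T2 [p1 p2 ->]]]; have [le1 le2] := sub_le_add p1 p2.
by exists (T1 + T2); split => //; exact: positive_operatorD.
Qed.

Lemma regular_positive_part T : dedekind_complete E -> regular_operators E T ->
  exists P, [/\ positive_operator P, op_le T P &
    forall U, positive_operator U -> op_le T U -> op_le P U].
Proof.
move=> dE rT; have [W [pW TW _]] := regular_majorant rT.
have lT : linear T by case: rT => T1 [T2 [[l1 _] [l2 _] ->]]; exact: linear_sub.
have [|P [lP PP]] := riesz_kantorovich (W := E) dE lT.
  move=> x x0; exists (W x) => z z0 zx.
  by apply: rle_trans (op_le_app TW z0) _; exact: (positive_mono pW.1 pW.2).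
have P0 : positive_operator P.
  split=> // x x0; have := (PP x x0).1 0 (rle_refl _) x0; by rewrite lin0.
exists P; split=> //.
  split; first exact: linear_sub.
  by move=> x x0; apply: (rle_sub (T x) (P x)).1; apply: (PP x x0).1 => //;
    exact: rle_refl.
move=> U [lU U0] TU; split; first exact: linear_sub.
move=> x x0; apply: (rle_sub (P x) (U x)).1; apply: (PP x x0).2 => z z0 zx.
by apply: rle_trans (op_le_app TU z0) _; exact: (positive_mono lU U0).
Qed.

Lemma op_le_opp_positive T S : op_le T S -> op_le (- T) S ->
  positive_operator S.
Proof.
move=> TS NTS; apply: positive_operator_double.
by have := positive_operatorD TS NTS; rewrite opprK addrACA addNr addr0.
Qed.

(** [|T| = (2 T)^+ - T]: if [S] majorizes [T] and [- T], then [S + T] is a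
    positive majorant of [2 T]. *)
Lemma regular_modulus T : dedekind_complete E -> regular_operators E T ->
  exists M, [/\ positive_operator M, op_le T M, op_le (- T) M &
    forall S, op_le T S -> op_le (- T) S -> op_le M S].
Proof.
move=> dE rT.
have rTT : regular_operators E (T + T).
  have := regularB rT (regularB (regularB rT rT) rT).
  by rewrite subrr sub0r opprK.
have [P [pP TP Pmin]] := regular_positive_part dE rTT.
have TM : op_le T (P - T) by rewrite /op_le -addrA -opprD.
have NTM : op_le (- T) (P - T) by rewrite /op_le opprK subrK.
exists (P - T); split => //; first exact: op_le_opp_positive TM NTM.
move=> S TS NTS; rewrite /op_le opprB addrA; apply: Pmin.
  by rewrite -[T]opprK.
by rewrite /op_le opprD addrA addrK.
Qed.

Lemma opnorm_mono S T : positive_operator S -> op_le S T ->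
  positive_operator T ->
  opnorm S <= opnorm T.
Proof.
move=> pS ST pT; have bT := positive_operator_bounded pT.
apply: opnorm_le (positive_operator_bounded pS) _ => x x1.
rewrite -norm_rabs; apply: (@le_trans _ _ `|T (rabs x)|).
  apply: norm_mono; first exact: rabs_ge0.
  apply: rle_trans (positive_abs_le _ pS.1 pS.2) _.
  by apply: op_le_app ST _; exact: rabs_ge0.
by apply: le_opnorm1 => //; rewrite norm_rabs.
Qed.

End PositiveOperators.

(** * Spaces of almost MW-operators *)

Section AlmostMWOperators.
Variables (R : realType) (E : banachLatticeType R).
Implicit Types (S T U M : E -> E).

Lemma aMW0 : aMW E E 0.
Proof.
split; first exact: positive_operator_bounded (positive_operator0 E).
move=> x f _ _ _; apply: (cvg_ext _ (cvg_cst _)) => n.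
by rewrite lin0//; exact: dual_linear.
Qed.

Lemma aMWD S T : aMW E E S -> aMW E E T -> aMW E E (S + T).
Proof.
move=> [[lS [M SM]] aS] [[lT [N TN]] aT]; split.
  split; first exact: linear_add.
  by exists (M + N) => x; rewrite mulrDl (le_trans (ler_normD _ _))// lerD.
move=> x f dx bx cf.
have c : (f n (S (x n)) + f n (T (x n)) : R) @[n --> \oo] --> (0 + 0 : R).
  by apply: cvgD; [exact: aS|exact: aT].
rewrite addr0 in c; apply: (cvg_ext _ c) => n.
by rewrite -linD//; exact: dual_linear.
Qed.

Lemma aMWZ (a : R) T : aMW E E T -> aMW E E (a *: T).
Proof.
move=> [[lT [M TM]] aT]; split.
  split; first exact: linear_scale.
  by exists (`|a| * M) => x; rewrite normrZ -mulrA ler_wpM2l.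
move=> x f dx bx cf.
have c : (a * f n (T (x n)) : R) @[n --> \oo] --> (a * 0 : R).
  by apply: cvgM; [exact: cvg_cst|exact: aT].
rewrite mulr0 in c; apply: (cvg_ext _ c) => n.
by rewrite -[RHS](linZ _ _ (dual_linear (f n))).
Qed.

Lemma aMWB S T : aMW E E S -> aMW E E T -> aMW E E (S - T).
Proof. by move=> aS aT; rewrite -scaleN1r; apply: aMWD => //; exact: aMWZ. Qed.

(** The adjoint [h |-> h \o S] is bounded, hence preserves weak convergence. *)
Lemma aMW_comp S T : bounded_operator S -> aMW E E T -> aMW E E (S \o T).
Proof.
move=> bS [bT aT]; have [lS _] := bS; split.
  split; first exact: linear_comp bT.1.
  exists (opnorm S * opnorm T) => x; apply: le_trans (le_opnorm _ bS) _.
  rewrite -mulrA; apply: ler_wpM2l; first exact: opnorm_ge0.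
  exact: le_opnorm.
move=> x f dx bx [g fg].
have adj_bound (h : dual E) v : `|h (S v)| <= `|h| * opnorm S * `|v|.
  by rewrite -mulrA (le_trans (le_dual_norm _ _))// ler_wpM2l//;
    exact: le_opnorm.
have /choice[adj adjE] (h : dual E) : exists h' : dual E, forall v,
  h' v = h (S v).
  have [h' h'E] : exists h' : dual E, h' = h \o S :> (E -> R^o).
    apply: exists_dual; split; first exact: linear_comp (dual_linear h) lS.
    by exists (`|h| * opnorm S) => v; exact: adj_bound.
  by exists h' => v; rewrite h'E.
have c : (adj (f n) (T (x n)) : R) @[n --> \oo] --> (0 : R).
  apply: (aT x (fun n => adj (f n))) => //; exists (adj g) => phi.
  have [psi psiE] : exists psi : dual (dual E), psi = phi \o adj :> (dual E ->
    R^o).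
    apply: exists_dual; split.
      move=> a h1 h2 /=; rewrite -(dual_linear phi); congr (phi _).
      apply: dual_ext => v; rewrite adjE -[RHS]/(a * adj h1 v + adj h2 v).
      by rewrite !adjE.
    exists (`|phi| * opnorm S) => h /=; apply: le_trans (le_dual_norm _ _) _.
    rewrite -mulrA ler_wpM2l//; apply: opnorm_le => [|v v1];
      first exact: dual_bounded.
    rewrite adjE mulrC; apply: le_trans (adj_bound h v) _.
    by rewrite ler_piMr// mulr_ge0// opnorm_ge0.
  by have := fg psi; rewrite psiE.
by apply: (cvg_ext _ c) => n; rewrite adjE.
Qed.

Lemma aMW_modulus_null T (x : nat -> E) (f : nat -> dual E) :
  positive_operator T -> aMW E E T -> disjoint_seq x -> bounded_fun x ->
  (exists g, weakly_cvg f g) ->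
  (rabs (f n) (T (rabs (x n))) : R) @[n --> \oo] --> (0 : R).
Proof.
move=> pT aT dx bx [g fg].
have c : (rpos (f n) (T (rabs (x n))) + rpos (- f n) (T (rabs (x n))) : R)
    @[n --> \oo] --> (0 + 0 : R).
  have dax : disjoint_seq (fun n => rabs (x n)).
    move=> n m nm; have := dx n m nm; rewrite !labsE !(rabs_id (rabs_ge0 _));
      exact.
  have bax : bounded_fun (fun n => rabs (x n)).
    have [C _ xC] := bounded_fun_norm_le bx.
    by apply: (bounded_by_fun (C := C)) => n; rewrite norm_rabs.
  apply: cvgD; apply: aMW_positive_part_null => //; try by move=> n;
    exact: rabs_ge0.
    by exists g.
  exists (- g) => phi; rewrite (linN _ (dual_linear phi)).
  by apply: (cvg_ext _ (cvgN (fg phi))) => n;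
    rewrite (linN _ (dual_linear phi)).
by rewrite addr0 in c; apply: (cvg_ext _ c) => n; rewrite dual_rabsE.
Qed.

Lemma dual_abs_bound (f : dual E) v u : rabs v <=V u -> `|f v| <= rabs f u.
Proof.
move=> vu; apply: (@le_trans _ _ (rabs f (rabs v))).
  rewrite [f in leLHS]rpos_sub dualB (le_trans (ler_normB _ _))//.
  by rewrite dual_rabsE; apply: lerD; apply: dual_abs_le; exact: rpos_ge0.
exact: (positive_mono (dual_linear (rabs f)) (rabs_ge0 f) vu).
Qed.

(** Domination up to an operator of small norm.  The error contributes at most
    [2 * `|f n| * opnorm U * `|x n|], and both sequences are bounded.
    With [U = 0] this is the usual domination property. *)
Theorem aMW_approx S : linear S ->
  (forall e : R, 0 < e -> exists T U,
    [/\ positive_operator T /\ aMW E E T, positive_operator U, opnorm U < e &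
        forall x, rabs (S x) <=V T (rabs x) + U (rabs x)]) ->
  aMW E E S.
Proof.
move=> lS apx; split.
  split => //; have [T [U [[pT _] pU _ SUT]]] := apx 1 ltr01.
  have [lTU [M TUM]] := positive_operator_bounded (positive_operatorD pT pU).
  exists M => x; rewrite -norm_rabs -[X in M * X]norm_rabs.
  by apply: le_trans (TUM _); apply: norm_mono (SUT x); exact: rabs_ge0.
move=> x f dx bx cf; have [C C0 fC] := weakly_cvg_bounded cf.
have [X X0 xX] := bounded_fun_norm_le bx.
apply/cvgrPdist_le => e e0.
have d0 : 0 < 2 * C * X + 1 by rewrite ltr_wpDl// !mulr_ge0.
have [|T [U [[pT aT] pU Ue SUT]]] := apx (e / 2 / (2 * C * X + 1));
  first by rewrite !divr_gt0.
have /cvgrPdist_le/(_ (e / 2)) := aMW_modulus_null pT aT dx bx cf.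
rewrite divr_gt0// => /(_ isT)[N _ NP]; exists N => // n /NP.
rewrite !sub0r !normrN => Tn; apply: le_trans (dual_abs_bound _ (SUT (x n))) _.
rewrite (linD _ _ (dual_linear _)) [leRHS]splitr; apply: lerD.
  by apply: le_trans Tn; exact: ler_norm.
apply: le_trans (ler_norm _) _; apply: le_trans (le_dual_norm _ _) _.
have bU := positive_operator_bounded pU; have U0 := opnorm_ge0 bU.
apply: (@le_trans _ _ ((2 * C) * (opnorm U * X))).
  apply: ler_pM => //; first by apply: le_trans (dual_norm_abs _) _;
    rewrite ler_wpM2l.
  by apply: le_trans (le_opnorm _ bU) _; rewrite norm_rabs ler_wpM2l.
rewrite mulrCA; have := ltW Ue; rewrite ler_pdivlMr// => /(le_trans _); apply.
by rewrite ler_wpM2l// lerDl.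
Qed.

Lemma aMW_dominated S T : positive_operator S -> op_le S T ->
  positive_operator T -> aMW E E T -> aMW E E S.
Proof.
move=> pS ST pT aT; apply: aMW_approx => [|e e0]; first by case: pS.
exists T, 0; split=> //; first exact: positive_operator0.
  apply: le_lt_trans e0; apply: opnorm_le => [|x _]; last by rewrite normr0.
  by apply: positive_operator_bounded; exact: positive_operator0.
move=> x; rewrite addr0; apply: rle_trans (positive_abs_le _ pS.1 pS.2) _.
by apply: op_le_app ST _; exact: rabs_ge0.
Qed.

Lemma regular_aMW_regular T : regular_aMW E T -> regular_operators E T.
Proof. by move=> [T1 [T2 [[p1 _] [p2 _] ->]]]; exists T1, T2. Qed.

Lemma regular_aMW_majorant T : regular_aMW E T ->
  exists U, [/\ positive_operator U /\ aMW E E U, op_le T U & op_le (- T) U].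
Proof.
move=> [T1 [T2 [[p1 a1] [p2 a2] ->]]]; have [le1 le2] := sub_le_add p1 p2.
exists (T1 + T2); split => //.
by split; [exact: positive_operatorD|exact: aMWD].
Qed.

(** [T = M - (M - T)], where [0 <= M - T <= 2 M]. *)
Lemma regular_aMW_of_majorant T M : op_le T M -> op_le (- T) M -> aMW E E M ->
  regular_aMW E T.
Proof.
move=> TM NTM aM; have pM := op_le_opp_positive TM NTM.
exists M, (M - T); split=> //; last by rewrite subKr.
split=> //; apply: (@aMW_dominated _ (M + M)) => //.
- by rewrite /op_le opprB [T - M]addrC addrA addrK -[T]opprK.
- exact: positive_operatorD.
- exact: aMWD.
Qed.

Lemma regular_aMWD S T : regular_aMW E S -> regular_aMW E T ->
  regular_aMW E (S + T).
Proof.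
move=> [S1 [S2 [[pS1 aS1] [pS2 aS2] ->]]] [T1 [T2 [[pT1 aT1] [pT2 aT2] ->]]].
exists (S1 + T1), (S2 + T2); split; last by rewrite opprD addrACA.
- by split; [exact: positive_operatorD|exact: aMWD].
- by split; [exact: positive_operatorD|exact: aMWD].
Qed.

Lemma regular_aMWZ (a : R) T : regular_aMW E T -> regular_aMW E (a *: T).
Proof.
move=> [T1 [T2 [[p1 a1] [p2 a2] ->]]]; have [a0|/ltW a0] := leP 0 a.
  exists (a *: T1), (a *: T2); rewrite scalerBr; split => //;
    by split; [exact: positive_operatorZ|exact: aMWZ].
exists (- a *: T2), (- a *: T1); rewrite -oppr_ge0 in a0.
split; last by rewrite !scaleNr opprK [RHS]addrC -scalerBr.
- by split; [exact: positive_operatorZ|exact: aMWZ].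
- by split; [exact: positive_operatorZ|exact: aMWZ].
Qed.

Lemma positive_aMW_regular T : positive_operator T -> aMW E E T ->
  regular_aMW E T.
Proof.
move=> pT aT; exists T, 0; rewrite subr0; split=> //.
by split; [exact: positive_operator0|exact: aMW0].
Qed.

Lemma regular_aMWB S T : regular_aMW E S -> regular_aMW E T ->
  regular_aMW E (S - T).
Proof. by move=> aS aT; rewrite -scaleN1r; apply: regular_aMWD => //;
  exact: regular_aMWZ. Qed.

Lemma regular_aMW_subspace : linear_subspace (regular_aMW E) (regular_operators E).
Proof.
split; [exact: regular_aMW_regular| |exact: regular_aMWD|exact: regular_aMWZ].
by apply: positive_aMW_regular; [exact: positive_operator0|exact: aMW0].
Qed.

Lemma regular_aMW_subalgebra : subalgebra (regular_aMW E) (regular_operators E).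
Proof.
split; first exact: regular_aMW_subspace.
move=> _ _ [S1 [S2 [[pS1 aS1] [pS2 aS2] ->]]] [T1 [T2 [[pT1 aT1] [pT2 aT2] ->]]].
have comp A B : positive_operator A -> positive_operator B -> aMW E E B ->
    regular_aMW E (A \o B).
  move=> pA pB aB; apply: positive_aMW_regular;
    first exact: positive_operator_comp.
  by apply: aMW_comp => //; exact: positive_operator_bounded.
have -> : (S1 - S2) \o (T1 - T2) = ((S1 \o T1) - (S1 \o T2)) - ((S2 \o T1) - (S2 \o T2)).
  apply/funext => x; rewrite /= -[LHS]/(S1 (T1 x - T2 x) - S2 (T1 x - T2 x)).
  by rewrite (linB _ _ pS1.1) (linB _ _ pS2.1).
by apply: regular_aMWB; apply: regular_aMWB; exact: comp.
Qed.

Lemma regular_aMW_full :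
  regular_aMW E = regular_operators E <-> aMW E E idfun.
Proof.
split=> [full|aI].
  have : regular_aMW E idfun.
    by rewrite full; apply: positive_regular; split.
  by move=> [T1 [T2 [[_ a1] [_ a2] ->]]]; exact: aMWB.
apply/seteqP; split=> T; first exact: regular_aMW_regular.
have aP P : positive_operator P -> aMW E E P.
  by move=> pP; apply: (aMW_comp (S := P) (T := idfun)) => //;
    exact: positive_operator_bounded.
by move=> [T1 [T2 [p1 p2 ->]]]; exists T1, T2; split => //; split => //;
  exact: aP.
Qed.

Section DedekindComplete.
Hypothesis dE : dedekind_complete E.

(** Both infima are attained at the least majorant of [T] and [- T]. *)
Lemma regular_aMW_normE T : regular_aMW E T ->
  regular_aMW_norm T = regular_norm T.
Proof.
move=> aT; have [M [pM TM NTM Mmin]] :=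
  regular_modulus dE (regular_aMW_regular aT).
have [U [[pU aU] TU NTU]] := regular_aMW_majorant aT.
have aM : aMW E E M by exact: aMW_dominated (Mmin U TU NTU) pU aU.
rewrite /regular_aMW_norm /regular_norm; set A := image _ _; set B := image _ _.
have AB : A `<=` B by move=> _ [S [[[lS _] _] TS NTS] <-]; exists S => //;
  case: lS.
have lbB : has_lbound B.
  exists 0 => _ [S [lS TS NTS] <-].
  exact: opnorm_ge0 (positive_operator_bounded (op_le_opp_positive TS NTS)).
have AM : A (opnorm M) by exists M.
apply/le_anti/andP; split; apply: lb_le_inf.
- by exists (opnorm M); exact: AB.
- move=> _ [S [lS TS NTS] <-]; apply: (@le_trans _ _ (opnorm M)).
    by apply: ge_inf AM; case: lbB => l lB; exists l => a /AB; exact: lB.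
  by apply: opnorm_mono => //; [exact: Mmin|exact: op_le_opp_positive TS NTS].
- by exists (opnorm M).
- by move=> a /AB Ba; exact: ge_inf.
Qed.

Lemma regular_aMW_closed : regular_norm_closed (regular_aMW E).
Proof.
move=> T rT apx; have [M [pM TM NTM Mmin]] := regular_modulus dE rT.
apply: (regular_aMW_of_majorant TM NTM).
apply: aMW_approx => [|e e0]; first by case: pM.
have [S aS] := apx e e0.
have [W [pW W1 W2]] := regular_majorant (regularB rT (regular_aMW_regular aS)).
move=> /inf_lt[|_ [U [lU DU NDU] <-] Ue].
  by exists (opnorm W), W => //; split => //; case: pW.
have pU := op_le_opp_positive DU NDU.
have [V [[pV aV] SV NSV]] := regular_aMW_majorant aS.
exists V, U; split => // x; have ax0 := rabs_ge0 x.
apply: rle_trans (positive_abs_le _ pM.1 pM.2) _.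
have MVU : op_le M (V + U).
  apply: Mmin.
    by have := positive_operatorD SV DU; rewrite opprB addrACA addKr.
  have := positive_operatorD NSV NDU.
  by rewrite /op_le !opprK addrACA [S + _]addrC subrK.
exact: (op_le_app MVU ax0).
Qed.

(** The supremum of [S] and [T] is [S + (T - S)^+], their infimum is
    [T - (T - S)^+]. *)
Lemma regular_aMW_sublattice :
  vector_sublattice (regular_aMW E) (regular_operators E).
Proof.
split; first exact: regular_aMW_subspace.
move=> S T aS aT; have rS := regular_aMW_regular aS;
  have rT := regular_aMW_regular aT.
have aD := regular_aMWB aT aS.
have [P [pP DP Pmin]] := regular_positive_part dE (regular_aMW_regular aD).
have [U [[pU aU] DU _]] := regular_aMW_majorant aD.
have aP : regular_aMW E P.
  by apply: positive_aMW_regular => //;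
    exact: aMW_dominated (Pmin U pU DU) pU aU.
split.
  have aV := regular_aMWD aS aP; exists (S + P) => //; split.
  - exact: regular_aMW_regular.
  - by rewrite /op_le [S + P]addrC addrK.
  - by move: DP; rewrite /op_le opprB addrA [P + S]addrC.
  - move=> W _ SW TW; rewrite /op_le opprD addrA; apply: Pmin => //.
    by rewrite /op_le opprB addrA subrK.
have aV := regular_aMWB aT aP; exists (T - P) => //; split.
- exact: regular_aMW_regular.
- by move: DP; rewrite /op_le !opprB addrCA.
- by rewrite /op_le opprB addrC subrK.
- move=> W _ WS WT; rewrite /op_le addrAC; apply: Pmin => //.
  by rewrite /op_le opprB [S - T]addrC addrACA subrr add0r addrC.
Qed.

Lemma regular_aMW_ideal : order_ideal (regular_aMW E) (regular_operators E).
Proof.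
split; first exact: regular_aMW_subspace.
move=> S T absS absT rS aT [_ SS NSS _] [_ _ _ Tmin] ST.
have [U [[pU aU] TU NTU]] := regular_aMW_majorant aT.
apply: (regular_aMW_of_majorant SS NSS).
apply: (aMW_dominated _ _ pU aU); first exact: op_le_opp_positive SS NSS.
by apply: (op_le_trans ST); apply: Tmin => //; exact: positive_regular.
Qed.

End DedekindComplete.
End AlmostMWOperators.

Theorem theorem2p6p5 (R : realType) (E : banachLatticeType R) :
  (subalgebra (regular_aMW E) (regular_operators E) /\
   (regular_aMW E = regular_operators E <-> aMW E E idfun)) /\
  (dedekind_complete E ->
   [/\ (forall T : E -> E, regular_aMW E T ->
          regular_aMW_norm T = regular_norm T),
       regular_norm_closed (regular_aMW E),
       riesz_subalgebra (regular_aMW E) (regular_operators E)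
     & order_ideal (regular_aMW E) (regular_operators E)]).
Proof.
split=> [|dE].
  by split; [exact: regular_aMW_subalgebra|exact: regular_aMW_full].
split; [exact: regular_aMW_normE|exact: regular_aMW_closed| |exact: regular_aMW_ideal].
by split; [exact: regular_aMW_subalgebra|exact: regular_aMW_sublattice].
Qed.
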